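(* Consider the hypotheses $h_W(x)=Wx$ with $W\in\mathbb R^{C\times d}$, and let $m:=Cd$. Assume that $\|x\|\le M$ for all $x\in X\subset\mathbb R^d$. Let $L(z,y)$ be a real-valued loss function on $\mathbb R^C\times Y$ such that, for every $y$, the map $z\mapsto L(z,y)$ is $\ell$-Lipschitz and $\beta$-smooth, and assume that $L(0,y)$ is independent of $y$. Let $D$ be a distribution over $X\times Y$ and let $\Theta:=\{W\in\mathbb R^{C\times d}:\|W\|_F\le R\}$. Fix $\sigma>0$ and let $\delta\in(0,1]$. Then, with probability at least $1-\delta$ over $S\sim D^n$, we have uniformly for all $W\in\Theta$, $$\begin{aligned}L_D(h_W)\le{}&L_S(h_W)+2\sqrt2\,\frac{\beta R\sigma CM^2}{\sqrt n}+4\beta CM^2\sigma^2\sqrt{\frac{2\ln(8/\delta)}{n}}\\&+\frac{M\ell\sqrt{m+1}}{2\sigma\sqrt n}\|W\|_F^2+\frac{M\ell\sigma\sqrt{m+1}}{\sqrt n}\left(\ln\frac2\delta+\frac12\right).\end{aligned}$$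
   Context: $L_D(h):=\mathbb E_{(x,y)\sim D}[L(h(x),y)]$ and, for $S=\{(x_i,y_i)\}_{i=1}^n$, $L_S(h):=\frac1n\sum_{i=1}^nL(h(x_i),y_i)$. A map $z\mapsto L(z,y)$ is $\beta$-smooth if it is differentiable with $\beta$-Lipschitz gradient (Euclidean norm). $\|\cdot\|_F$ is the Frobenius norm. *)

(* Defs.v *)
From HB Require Import structures.
From mathcomp Require Import all_boot all_order all_algebra.
From mathcomp Require Import all_classical all_reals all_analysis.
Import Order.TTheory GRing.Theory Num.Theory.
Import numFieldNormedType.Exports.

Set Implicit Arguments.
Unset Strict Implicit.
Unset Printing Implicit Defensive.

Local Open Scope classical_set_scope.
Local Open Scope ring_scope.

(* The library norm on matrices is the sup norm, hence these definitions. *)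
Definition frobenius_norm (R : realType) (m n : nat) (A : 'M[R]_(m, n)) : R :=
  Num.sqrt (\sum_i \sum_j A i j ^+ 2).

Definition euclidean_norm (R : realType) (n : nat) (v : 'cV[R]_n) : R :=
  Num.sqrt (\sum_i v i 0 ^+ 2).

Definition euclidean_lipschitz (R : realType) (n p : nat) (k : R)
    (f : 'cV[R]_n -> 'cV[R]_p) : Prop :=
  forall u v, euclidean_norm (f u - f v) <= k * euclidean_norm (u - v).

Definition euclidean_lipschitz_real (R : realType) (n : nat) (k : R)
    (f : 'cV[R]_n -> R) : Prop :=
  forall u v, `|f u - f v| <= k * euclidean_norm (u - v).

Definition gradient (R : realType) (n : nat) (f : 'cV[R]_n -> R)
    (z : 'cV[R]_n) : 'cV[R]_n :=
  \col_i 'd f z (delta_mx i 0).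

(* [differentiable] refers to the sup norm, which induces the same notion as
   the Euclidean norm. *)
Definition smooth (R : realType) (n : nat) (beta : R) (f : 'cV[R]_n -> R) :
    Prop :=
  (forall z, differentiable f z) /\ euclidean_lipschitz beta (gradient f).

(* R^d with its Borel sigma-algebra. *)
Definition borel_cV (R : realType) (d : nat) := g_sigma_algebraType (@open 'cV[R]_d).

Section iid.
Context {d : measure_display} {T : measurableType d} {R : realType}.
Variable P : probability T R.

Definition cons_tuple (n : nat) (p : T * n.-tuple T) : n.+1.-tuple T :=
  [tuple of p.1 :: p.2].

Lemma measurable_cons_tuple n : measurable_fun setT (@cons_tuple n).
Proof. by apply: measurable_cons. Qed.

HB.instance Definition _ n :=
  isMeasurableFun.Build _ _ _ _ (@cons_tuple n) (@measurable_cons_tuple n).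

(* The n-fold product probability P^n on T^n. *)
Fixpoint iid_probability (n : nat) : probability (n.-tuple T) R :=
  match n with
  | 0 => \d_([tuple])
  | k.+1 => distribution (P \x iid_probability k)%E (@cons_tuple k)
  end.

Lemma iid_probability_box n (A : 'I_n -> set T) :
  (forall i, measurable (A i)) ->
  iid_probability n [set s | forall i, A i (tnth s i)] = (\prod_(i < n) P (A i))%E.
Proof.
elim: n A => [|n IH] A mA.
  rewrite big_ord0 /= diracE mem_set//=; by case.
rewrite big_ord_recl -IH//= /distribution /pushforward.
rewrite (_ : _ @^-1` _ =
    A ord0 `*` [set s | forall i, A (lift ord0 i) (tnth s i)]); last first.
  apply/seteqP; split=> -[x s] /= H.
    split; first exact: (H ord0).
    by move=> i; have := H (lift ord0 i); rewrite tnthS.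
  by move=> i; case: (unliftP ord0 i) => [j|] ->; [rewrite tnthS; exact: H.2 | exact: H.1].
rewrite product_measure1E//.
rewrite (_ : [set s | _] = \bigcap_(i in [set: 'I_n])
    ((@tnth _ T)^~ i @^-1` A (lift ord0 i))); last first.
  by apply/seteqP; split=> s /= H i; [move=> _; exact: H | exact: (H i I)].
apply: fin_bigcap_measurable => // i _.
by rewrite -[X in measurable X]setTI; exact: measurable_tnth.
Qed.

End iid.

(* The event A need not be known to be measurable. *)
Definition with_probability_at_least (d : measure_display)
    (T : measurableType d) (R : realType) (P : probability T R) (p : R)
    (A : set T) : Prop :=
  exists E : set T, [/\ measurable E, E `<=` A & (p%:E <= P E)%E].

Definition linear_hypothesis (R : realType) (C d : nat) (W : 'M[R]_(C, d)) :
    'cV[R]_d -> 'cV[R]_C :=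
  fun x => W *m x.

Definition loss_at (R : realType) (C d : nat) (Y : Type)
    (L : 'cV[R]_C -> Y -> R) (h : 'cV[R]_d -> 'cV[R]_C)
    (p : borel_cV R d * Y) : R :=
  L (h p.1) p.2.

Definition population_risk (R : realType) (C d : nat) (dY : measure_display)
    (Y : measurableType dY) (L : 'cV[R]_C -> Y -> R)
    (D : probability (borel_cV R d * Y)%type R)
    (h : 'cV[R]_d -> 'cV[R]_C) : \bar R :=
  'E_D[loss_at L h].

Definition empirical_risk (R : realType) (C d : nat) (Y : Type)
    (L : 'cV[R]_C -> Y -> R) (n : nat) (S : n.-tuple (borel_cV R d * Y))
    (h : 'cV[R]_d -> 'cV[R]_C) : R :=
  n%:R^-1 * \sum_(i < n) loss_at L h (tnth S i).

(* Main.v *)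
Require Import Defs.
From HB Require Import structures.
From mathcomp Require Import all_boot all_order all_algebra.
From mathcomp Require Import all_classical all_reals all_analysis.
From mathcomp Require Import measurable_realfun ring lra zify.
Import Order.TTheory GRing.Theory Num.Theory.
Import numFieldNormedType.Exports.

(* Write Delta(W) = L_D(h_W) - L_S(h_W). Smoothing the weights by a centred
   Gaussian of variance s^2 and applying the PAC-Bayes change of measure from
   N(0, s^2 I) to N(W, s^2 I), together with Hoeffding's bound on the exponential
   moment of Delta, controls E Delta(W + sigma U); this gives the two Lipschitz
   terms. The smoothing error Delta(W) - E Delta(W + sigma U) is telescoped over
   the scales sigma / 2^j. The j-th difference is E G_j(W + sigma U / 2^j), where
   G_j compares a loss with its average over a further Gaussian perturbation; by
   smoothness G_j is bounded by O(beta C M^2 sigma^2 / 4^j), so PAC-Bayes applies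
   again, now with a relative entropy |W|^2 4^j / (2 sigma^2), and the resulting
   bounds sum geometrically. Neither symmetrization nor a contraction inequality
   is needed: n scales suffice, and one Markov inequality for a weighted sum of
   the exponential moments serves all of them simultaneously. *)

Set Implicit Arguments.
Unset Strict Implicit.
Unset Printing Implicit Defensive.

Local Open Scope classical_set_scope.
Local Open Scope ring_scope.

(** * Gaussian measures *)

(** A single change of measure cannot reach [w] itself: its relative entropy |w|^2 / (2 s^2) blows
    up as s tends to 0. The telescoping pays for this growth with the shrinking range of the G_j.
    Once the inverse temperature is tuned to level j, the cost is about sqrt(entropy) times range
    over sqrt n, that is 2^j 4^-j / sqrt n; hence the geometric sum. Doubling a scale s means
    convolving with variance 3 s^2, since (2 s)^2 = s^2 + 3 s^2; hence the factors sqrt 3 and 3. The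
    loss is unbounded in the weights. Subtracting the constant L(0,y) changes no gap and makes the
    loss at u at most M l |u|, so Hoeffding's exponent at the coarsest scale is quadratic in u. Its
    exponential has Gaussian integral at most exp(1/2) if the inverse temperature carries 1 /
    sqrt(m+1): this is the origin of sqrt(m+1) and of the summand 1/2. Smoothing errors are of
    second order in the scale because U and -U have the same law, which turns first differences into
    second differences. *)

Section lebesgue_translation.
Context {R : realType}.
Local Notation mu := (@lebesgue_measure R).

Lemma measurable_addr (a : R) :
  measurable_fun [set: measurableTypeR R] (fun x => a + x : measurableTypeR R).
Proof. exact: measurable_funD. Qed.

(** Both measures agree on half-open intervals, and these determine Lebesgue measure. *)
Lemma lebesgue_measure_addr (a : R) (A : set R) : measurable A ->
  pushforward mu (fun x => a + x : measurableTypeR R) A = mu A.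
Proof.
move=> mA.
pose f : measurableTypeR R -> measurableTypeR R := fun x => a + x.
pose fM := isMeasurableFun.Build _ _ _ _ f (measurable_addr a).
pose fP : {mfun _ >-> _} := HB.pack f fM.
apply/esym.
apply: (@lebesgue_measure_unique R (pushforward mu fP)) => //= _ [[x y]] _ <-.
rewrite /pushforward/= (_ : _ @^-1` _ = `]x - a, y - a]%classic); last first.
  by apply/seteqP; split=> z /=; rewrite !in_itv/= /f => /andP[? ?];
    apply/andP; split; lra.
rewrite !lebesgue_measure_itv/= !lte_fin ltrD2r.
by case: ifP => // _; rewrite -!EFinD; congr EFin; ring.
Qed.

Lemma ge0_integral_addr (a : R) (f : R -> \bar R) :
  measurable_fun [set: R] f -> (forall x, (0 <= f x)%E) ->
  (\int[mu]_x f x = \int[mu]_x f (a + x)%R)%E.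
Proof.
move=> mf f0; pose g : measurableTypeR R -> measurableTypeR R := fun x => a + x.
rewrite [RHS](_ : _ = \int[mu]_(x in g @^-1` setT) (f \o g) x)%E//.
rewrite -(@ge0_integral_pushforward _ _ _ _ _ _ (measurable_addr a))//.
apply: eq_measure_integral => [|mg A mA _]; first exact: measurable_addr.
exact/esym/lebesgue_measure_addr.
Qed.

Lemma ge0_integral_opp (f : R -> \bar R) :
  measurable_fun [set: R] f -> (forall x, (0 <= f x)%E) ->
  (\int[mu]_x f x = \int[mu]_x f (- x)%R)%E.
Proof.
move=> mf f0.
pose g : measurableTypeR R -> measurableTypeR R := -%R.
have mN : measurable_fun setT g by exact: oppr_measurable.
rewrite [RHS](_ : _ = \int[mu]_(x in g @^-1` setT) (f \o g) x)%E//.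
rewrite -(@ge0_integral_pushforward _ _ _ _ _ _ mN)//.
by apply: eq_measure_integral => //= A mA _; exact/esym/lebesgue_measureN.
Qed.

End lebesgue_translation.

Section normal.
Context {R : realType}.
Local Notation mu := (@lebesgue_measure R).
Implicit Types (s a t : R) (f : R -> \bar R).

(** The Radon-Nikodym derivative with respect to Lebesgue measure and [normal_pdf] have the same
    integral over every measurable set, so they agree almost everywhere. *)
Lemma ge0_integral_normal_prob s f :
  measurable_fun [set: R] f -> (forall x, (0 <= f x)%E) ->
  (\int[normal_prob 0 s]_x f x = \int[mu]_x (f x * (normal_pdf 0 s x)%:E))%E.
Proof.
move=> mf f0.
have dom := @normal_prob_dominates R 0 s.
have mpdf : measurable_fun [set: R] (fun x => (normal_pdf 0 s x)%:E).
  by apply/measurable_EFinP; exact: measurable_normal_pdf.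
have ih := Radon_Nikodym_SigmaFinite.f_integrable dom.
have h0 := Radon_Nikodym_SigmaFinite.f_ge0 dom.
rewrite -(Radon_Nikodym_SigmaFinite.change_of_variables dom)//.
apply: ge0_ae_eq_integral => //.
- apply: emeasurable_funM => //; exact: (measurable_int mu).
- exact: emeasurable_funM.
- by move=> x _; rewrite mule_ge0.
- by move=> x _; rewrite mule_ge0// lee_fin normal_pdf_ge0.
apply: ae_eqe_mul2l; apply: integral_ae_eq => //= E _ mE.
by rewrite -(Radon_Nikodym_SigmaFinite.f_integral dom).
Qed.

End normal.

Section normal.
Context {R : realType}.
Local Notation mu := (@lebesgue_measure R).
Implicit Types (s a t : R) (f : R -> \bar R).

Lemma normal_pdf_exp (m s x : R) : 0 < s ->
  normal_pdf m s x =
  (s * Num.sqrt (pi *+ 2))^-1 * expR (- (x - m) ^+ 2 / (s ^+ 2 *+ 2)).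
Proof.
move=> s0; rewrite normal_pdfE ?gt_eqF// /normal_peak /normal_fun -mulrnAr.
by rewrite sqrtrM ?sqr_ge0// sqrtr_sqr gtr0_norm.
Qed.

Lemma measurable_normal_pdfE (m s : R) :
  measurable_fun [set: R] (fun x => (normal_pdf m s x)%:E).
Proof. by apply/measurable_EFinP; exact: measurable_normal_pdf. Qed.

(** One-dimensional Cameron-Martin formula: the exponential is the ratio of the densities at a + x
    and at x. *)
Lemma ge0_integral_normal_shift s a f : 0 < s ->
  measurable_fun [set: R] f -> (forall x, (0 <= f x)%E) ->
  (\int[normal_prob 0 s]_x f x =
   \int[normal_prob 0 s]_x
     (f (a + x)%R * (expR (- (a * x) / s ^+ 2 - a ^+ 2 / (s ^+ 2 *+ 2)))%:E))%E.
Proof.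
move=> s0 mf f0.
have mfa : measurable_fun [set: R] (fun x => f (a + x)).
  by apply: measurableT_comp => //; exact: measurable_funD.
have mexp : measurable_fun [set: R]
    (fun x => (expR (- (a * x) / s ^+ 2 - a ^+ 2 / (s ^+ 2 *+ 2)))%:E).
  apply/measurable_EFinP; apply: measurableT_comp => //.
  apply: measurable_funB => //; apply: measurable_funM => //.
  by apply: measurableT_comp => //; apply: measurable_funM.
rewrite !ge0_integral_normal_prob//; last 2 first.
- exact: emeasurable_funM.
- by move=> x; rewrite mule_ge0// lee_fin expR_ge0.
rewrite (ge0_integral_addr a); last 2 first.
- by apply: emeasurable_funM => //; exact: measurable_normal_pdfE.
- by move=> x; rewrite mule_ge0// lee_fin normal_pdf_ge0.
apply: eq_integral => x _; rewrite -muleA -EFinM; congr (_ * _%:E)%E.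
rewrite !normal_pdf_exp// mulrCA -expRD; congr (_ * expR _).
by field; rewrite gt_eqF.
Qed.

Lemma ge0_integral_normal_opp s f : 0 < s ->
  measurable_fun [set: R] f -> (forall x, (0 <= f x)%E) ->
  (\int[normal_prob 0 s]_x f x = \int[normal_prob 0 s]_x f (- x)%R)%E.
Proof.
move=> s0 mf f0.
rewrite !ge0_integral_normal_prob//; last first.
  by apply: measurableT_comp => //; exact: oppr_measurable.
rewrite ge0_integral_opp; last 2 first.
- by apply: emeasurable_funM => //; exact: measurable_normal_pdfE.
- by move=> x; rewrite mule_ge0// lee_fin normal_pdf_ge0.
apply: eq_integral => x _; congr (_ * _%:E)%E.
by rewrite !normal_pdf_exp// !subr0 sqrrN.
Qed.

Lemma integral_normal_expR_sqr s t : 0 < s -> 0 < 1 - 2 * t * s ^+ 2 ->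
  (\int[normal_prob 0 s]_x (expR (t * x ^+ 2))%:E =
   ((Num.sqrt (1 - 2 * t * s ^+ 2))^-1)%:E)%E.
Proof.
move=> s0 q0; rewrite ge0_integral_normal_prob; last 2 first.
- apply/measurable_EFinP; apply: measurableT_comp => //.
  by apply: measurable_funM => //; exact: measurable_funX.
- by move=> x; rewrite lee_fin expR_ge0.
set q := Num.sqrt _.
have q1 : 0 < q by rewrite sqrtr_gt0.
have qE : q ^+ 2 = 1 - 2 * t * s ^+ 2 by rewrite sqr_sqrtr// ltW.
have pi0 : 0 < Num.sqrt (pi *+ 2 : R) by rewrite sqrtr_gt0 pmulrn_lgt0// pi_gt0.
(* Multiplying the density of deviation s by exp(t x^2) gives 1 / q times the density of deviation s
   / q. *)
under eq_integral => x _.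
  rewrite -EFinM (_ : _ * _ = q^-1 * normal_pdf 0 (s / q) x); last first.
    rewrite !normal_pdf_exp ?divr_gt0// mulrCA -expRD [RHS]mulrA; congr (_ * expR _).
      by field; rewrite !gt_eqF.
    rewrite !subr0 expr_div_n qE; field.
    by rewrite -qE !expf_neq0 ?gt_eqF.
  rewrite EFinM; over.
rewrite ge0_integralZl//; last 3 first.
- exact: measurable_normal_pdfE.
- by move=> x _; rewrite lee_fin normal_pdf_ge0.
- by rewrite lee_fin invr_ge0 ltW.
by rewrite integral_normal_pdf mule1.
Qed.

(** The second moment is read off the exponential moment through 1 + t x^2 <= exp(t x^2), with t
    tending to 0. *)
Lemma integral_normal_sqr_le s : 0 < s ->
  (\int[normal_prob 0 s]_x (x ^+ 2)%:E <= (s ^+ 2)%:E)%E.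
Proof.
move=> s0.
have mx2 : measurable_fun [set: R] (fun x : R => (x ^+ 2)%:E).
  by apply/measurable_EFinP; exact: measurable_funX.
have H r : 1 < r -> (\int[normal_prob 0 s]_x (x ^+ 2)%:E <= (s ^+ 2 * r ^+ 2)%:E)%E.
  move=> r1; have r0 : 0 < r by rewrite (lt_trans _ r1).
  (* This t makes the exponential moment equal to r, so the second moment is at most (r - 1) / t,
     hence at most s^2 r^2. *)
  pose t := (1 - r ^- 2) / (2 * s ^+ 2).
  have tE : 1 - 2 * t * s ^+ 2 = r ^- 2 by rewrite /t; field; rewrite !gt_eqF.
  have t0 : 0 < t.
    rewrite divr_gt0 ?mulr_gt0 ?exprn_gt0// subr_gt0 invf_lt1 ?exprn_gt0//.
    by rewrite exprn_egt1.
  have := @integral_normal_expR_sqr s t s0.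
  rewrite tE invr_gt0 exprn_gt0// => /(_ isT).
  rewrite -exprVn sqrtr_sqr gtr0_norm ?invr_gt0// invrK => E.
  have : (\int[normal_prob 0 s]_x (1 + t * x ^+ 2)%:E <= r%:E)%E.
    rewrite -E; apply: ge0_le_integral => //.
    - by move=> x _; rewrite lee_fin addr_ge0// mulr_ge0 ?sqr_ge0// ltW.
    - by apply/measurable_EFinP; apply: measurable_funD => //;
       apply: measurable_funM => //; exact: measurable_funX.
    - apply/measurable_EFinP; apply: measurableT_comp => //.
      by apply: measurable_funM => //; exact: measurable_funX.
    - by move=> x _; rewrite lee_fin expR_ge1Dx.
  under eq_integral do rewrite EFinD EFinM.
  rewrite ge0_integralD//; last 2 first.
  - by move=> x _; rewrite mule_ge0// lee_fin ?sqr_ge0// ltW.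
  - exact: measurable_funeM.
  rewrite integral_cst// [X in (_ * X)%E]probability_setT mule1.
  rewrite ge0_integralZl//; last 2 first.
  - by move=> x _; rewrite lee_fin sqr_ge0.
  - by rewrite lee_fin ltW.
  have I0 : (0 <= \int[normal_prob 0 s]_x (x ^+ 2)%:E)%E.
    by apply: integral_ge0 => x _; rewrite lee_fin sqr_ge0.
  move: I0; case: (\int[_]_x _)%E => [v|//|//]; last first.
    by rewrite gt0_muley ?lte_fin.
  rewrite -EFinM -EFinD !lee_fin => v0 le.
  have : v <= (r - 1) / t by rewrite ler_pdivlMr// mulrC; lra.
  move/le_trans; apply; rewrite ler_pdivrMr// /t.
  rewrite (_ : _ * _ = (r ^+ 2 - 1) / 2); last by field; rewrite !gt_eqF.
  rewrite ler_pdivlMr//.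
  by nra.
(* The value r = 2 serves only to show that the second moment is finite. *)
have := H 2 ltac:(lra); have I0 : (0 <= \int[normal_prob 0 s]_x (x ^+ 2)%:E)%E.
  by apply: integral_ge0 => x _; rewrite lee_fin sqr_ge0.
move: H I0; case: (\int[_]_x _)%E => [v|//|//] H v0 _.
rewrite lee_fin leNgt; apply/negP => sv.
pose r2 := v / s ^+ 2.
have r21 : 1 < r2 by rewrite ltr_pdivlMr ?mul1r// exprn_gt0.
(* In place of the limit r -> 1: if v exceeded s^2, this r would put s^2 r^2 strictly between s^2
   and v, against [H]. *)
pose r := Num.sqrt ((1 + r2) / 2).
have rE : r ^+ 2 = (1 + r2) / 2 by rewrite sqr_sqrtr//; lra.
have r1 : 1 < r by rewrite -sqrtr1 ltr_sqrt; lra.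
have := H r r1; rewrite lee_fin rE => h.
have vE : v = r2 * s ^+ 2 by rewrite /r2 mulfVK// gt_eqF// exprn_gt0.
have : 0 < s ^+ 2 by rewrite exprn_gt0.
by move: h sv; rewrite vE; nra.
Qed.
End normal.

Section normal_convolution.
Context {R : realType}.
Local Notation mu := (@lebesgue_measure R).

Lemma ge0_integral_normal_convolution (a b c : R) (f : R -> \bar R) :
  0 < a -> 0 < b -> 0 < c -> c ^+ 2 = a ^+ 2 + b ^+ 2 ->
  measurable_fun [set: R] f -> (forall x, (0 <= f x)%E) ->
  (\int[normal_prob 0 a]_x \int[normal_prob 0 b]_y f (x + y)%R =
   \int[normal_prob 0 c]_x f x)%E.
Proof.
move=> a0 b0 c0 cab mf f0.
have mfxy : measurable_fun [set: measurableTypeR R * measurableTypeR R]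
    (fun z => f (z.1 + z.2)).
  by apply: measurableT_comp => //; exact: measurable_funD.
have mpdf2 : measurable_fun [set: measurableTypeR R * measurableTypeR R]
    (fun z => (normal_pdf 0 b (z.2 - z.1) * normal_pdf 0 a z.1)%:E).
  apply/measurable_EFinP; apply: measurable_funM.
    apply: (@measurableT_comp _ _ _ _ _ _ (normal_pdf 0 b)).
      exact: measurable_normal_pdf.
    exact: measurable_funB.
  apply: (@measurableT_comp _ _ _ _ _ _ (normal_pdf 0 a)) => //.
  exact: measurable_normal_pdf.
rewrite ge0_integral_normal_prob; last 2 first.
- exact: (@measurable_fun_fubini_tonelli_F _ _ (measurableTypeR R)
    (measurableTypeR R) R (normal_prob 0 b) (fun z => f (z.1 + z.2)) mfxy).
- by move=> x; exact: integral_ge0.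
transitivity (\int[mu]_x \int[mu]_z
    (f z * (normal_pdf 0 b (z - x) * normal_pdf 0 a x)%:E))%E.
  apply: eq_integral => x _.
  have mfx : measurable_fun [set: R] (fun y => f (x + y)).
    by apply: measurableT_comp => //; exact: measurable_funD.
  rewrite ge0_integral_normal_prob// (ge0_integral_addr (- x)); last 2 first.
  - by apply: emeasurable_funM => //; exact: measurable_normal_pdfE.
  - by move=> y; rewrite mule_ge0// lee_fin normal_pdf_ge0.
  rewrite -ge0_integralZr//; last 3 first.
  - apply: emeasurable_funM.
    + apply: measurableT_comp => //.
      by do 2 (apply: measurable_funD => //).
    + apply/measurable_EFinP; apply: (@measurableT_comp _ _ _ _ _ _ (normal_pdf 0 b)).
        exact: measurable_normal_pdf.
      exact: measurable_funD.
  - by move=> y _; rewrite mule_ge0// lee_fin normal_pdf_ge0.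
  - by rewrite lee_fin normal_pdf_ge0.
  apply: eq_integral => z _.
  by rewrite addNKr -muleA -EFinM (addrC (- x)).
rewrite (fubini_tonelli (fun z : measurableTypeR R * measurableTypeR R =>
    f z.2 * (normal_pdf 0 b (z.2 - z.1) * normal_pdf 0 a z.1)%:E)%E); last 2 first.
- by apply: emeasurable_funM => //; exact: measurableT_comp.
- by move=> z; rewrite mule_ge0// lee_fin mulr_ge0 ?normal_pdf_ge0.
rewrite ge0_integral_normal_prob//; apply: eq_integral => z _ /=.
have pi0 : 0 < Num.sqrt (pi *+ 2 : R) by rewrite sqrtr_gt0 pmulrn_lgt0// pi_gt0.
(* Completing the square factors the joint density into the density of the sum z and the conditional
   density of x given z, which is normal with mean z a^2 / c^2 and deviation a b / c. *)
transitivity (\int[mu]_x (f z * (normal_pdf 0 c z)%:E *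
    (normal_pdf (z * a ^+ 2 / c ^+ 2) (a * b / c) x)%:E))%E.
  apply: eq_integral => x _; rewrite -muleA -EFinM; congr (_ * _%:E)%E.
  rewrite !normal_pdf_exp ?divr_gt0 ?mulr_gt0//.
  rewrite [LHS]mulrACA [RHS]mulrACA -!expRD; congr (_ * expR _).
    by field; rewrite !gt_eqF.
  have c2 : c ^+ 2 != 0 by rewrite expf_neq0// gt_eqF.
  rewrite !subr0 expr_div_n exprMn; move: c2; rewrite cab => c2.
  by field; rewrite c2 !gt_eqF.
rewrite ge0_integralZl//; last 3 first.
- exact: measurable_normal_pdfE.
- by move=> x _; rewrite lee_fin normal_pdf_ge0.
- by rewrite mule_ge0// lee_fin normal_pdf_ge0.
by rewrite integral_normal_pdf mule1.
Qed.

End normal_convolution.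

(** * Integration against product measures *)

Section iid_integral.
Context {d : measure_display} {T : measurableType d} {R : realType}.
Variable P : probability T R.

Lemma integral_iid0 (f : 0.-tuple T -> \bar R) :
  (\int[iid_probability P 0]_s f s = f [tuple])%E.
Proof.
rewrite (eq_integral (cst (f [tuple]))); last first.
  by move=> s _; rewrite (tuple0 s).
by rewrite integral_cst// [X in (_ * X)%E]probability_setT mule1.
Qed.

Lemma ge0_integral_iidS n (f : n.+1.-tuple T -> \bar R) :
  measurable_fun setT f -> (forall s, (0 <= f s)%E) ->
  (\int[iid_probability P n.+1]_s f s =
   \int[P]_x \int[iid_probability P n]_s f [tuple of x :: s])%E.
Proof.
move=> mf f0.
rewrite /= ge0_integral_distribution// (fubini_tonelli1 (f \o @Defs.cons_tuple _ T n))//.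
- by apply: measurableT_comp => //; exact: measurable_cons_tuple.
- by move=> x; exact: f0.
Qed.

Lemma ge0_integral_iid_prod_le n (f : T -> \bar R) (a : R) :
  measurable_fun setT f -> (forall s, (0 <= f s)%E) ->
  (\int[P]_x f x <= a%:E)%E ->
  (\int[iid_probability P n]_s \prod_(i < n) f (tnth s i) <= (a ^+ n)%:E)%E.
Proof.
move=> mf f0 fa.
have a0 : (0 <= a%:E)%E by apply: le_trans fa; exact: integral_ge0.
have mprod k : measurable_fun [set: k.-tuple T]
    (fun s => \prod_(i < k) f (tnth s i))%E.
  elim: k => [|k IH].
    under eq_fun do rewrite big_ord0.
    exact: measurable_cst.
  under eq_fun do rewrite big_ord_recl.
  apply: emeasurable_funM.
    by apply: measurableT_comp => //; exact: measurable_tnth.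
  rewrite (_ : (fun _ => _) =
     (fun s : k.-tuple T => \prod_(i < k) f (tnth s i))%E \o
     (fun s : k.+1.-tuple T => [tuple of behead s])).
    by apply: measurableT_comp => //; exact: measurable_behead.
  apply/funext => s /=; apply: eq_bigr => i _; congr f.
  by rewrite [in LHS](tuple_eta s) tnthS.
have prod0 k (s : k.-tuple T) : (0 <= \prod_(i < k) f (tnth s i))%E.
  by elim/big_ind : _ => //; exact: mule_ge0.
elim: n => [|n IH].
  by rewrite integral_iid0// big_ord0 expr0.
rewrite ge0_integral_iidS//.
set I := (\int[iid_probability P n]_s \prod_(i < n) f (tnth s i))%E in IH.
have I0 : (0 <= I)%E by exact: integral_ge0.
rewrite (eq_integral (fun x => f x * I)%E); last first.
  move=> x _; rewrite -ge0_integralZl//; last exact: mprod.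
  apply: eq_integral => s _.
  by rewrite big_ord_recl tnth0; under eq_bigr do rewrite tnthS.
rewrite ge0_integralZr//.
by rewrite exprS EFinM; apply: lee_pmul => //; exact: integral_ge0.
Qed.

End iid_integral.

Local Opaque iid_probability integral normal_prob.

(** * Isotropic Gaussian vectors *)

Section gaussian_tuple.
Context {R : realType}.
Local Notation RR := (measurableTypeR R).
Local Notation gauss s m := (iid_probability (normal_prob (0 : R) s) m).

Definition add_tuple m (w u : m.-tuple R) : m.-tuple RR :=
  [tuple tnth w i + tnth u i | i < m].

Definition opp_tuple m (u : m.-tuple R) : m.-tuple RR :=
  [tuple - tnth u i | i < m].

Lemma add_tuple_cons m (x y : R) (w u : m.-tuple R) :
  add_tuple [tuple of x :: w] [tuple of y :: u] =
  [tuple of (x + y) :: add_tuple w u].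
Proof.
by apply: eq_from_tnth => i; rewrite tnth_mktuple;
  have [j ->|->] := unliftP ord0 i; rewrite ?tnth0 // !tnthS tnth_mktuple.
Qed.

Lemma opp_tuple_cons m (x : R) (u : m.-tuple R) :
  opp_tuple [tuple of x :: u] = [tuple of - x :: opp_tuple u].
Proof.
by apply: eq_from_tnth => i; rewrite tnth_mktuple;
  have [j ->|->] := unliftP ord0 i; rewrite ?tnth0 // !tnthS tnth_mktuple.
Qed.

Lemma measurable_tnthR m (i : 'I_m) :
  measurable_fun [set: m.-tuple RR] (fun u => tnth u i : R).
Proof. exact: measurable_tnth. Qed.

Lemma measurable_add_tuple m d (T : measurableType d) (f g : T -> m.-tuple RR) :
  measurable_fun setT f -> measurable_fun setT g ->
  measurable_fun setT (fun x => add_tuple (f x) (g x)).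
Proof.
move=> mf mg; apply/measurable_fun_tnthP => i.
rewrite (_ : _ \o _ = fun x => tnth (f x) i + tnth (g x) i).
  apply: measurable_funD.
    exact: (measurableT_comp (measurable_tnthR i) mf).
  exact: (measurableT_comp (measurable_tnthR i) mg).
by apply/funext => z /=; rewrite tnth_mktuple.
Qed.

Lemma measurable_add_tupler m (w : m.-tuple R) :
  measurable_fun [set: m.-tuple RR] (add_tuple w : _ -> m.-tuple RR).
Proof. by apply: measurable_add_tuple. Qed.

Lemma measurable_opp_tuple m : measurable_fun [set: m.-tuple RR] (@opp_tuple m : _ -> m.-tuple RR).
Proof.
apply/measurable_fun_tnthP => i.
rewrite (_ : _ \o _ = fun z : m.-tuple RR => - tnth z i).
  by apply: measurableT_comp; [exact: oppr_measurable|exact: measurable_tnthR].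
by apply/funext => z /=; rewrite tnth_mktuple.
Qed.

Lemma measurable_cons_pair m : measurable_fun [set: RR * m.-tuple RR]
  (fun z => [tuple of z.1 :: z.2]).
Proof. by apply: measurable_cons. Qed.

Lemma measurable_cons_tupler m (x : R) : measurable_fun [set: m.-tuple RR]
  (fun z : m.-tuple RR => [tuple of (x : RR) :: z]).
Proof. by apply: measurable_cons. Qed.

(** Cameron-Martin formula for vectors, by induction on the coordinates: the exponents of the
    one-dimensional factors add up. *)
Lemma ge0_integral_gauss_shift (s : R) m (w : m.-tuple R) (f : m.-tuple RR -> \bar R) :
  0 < s -> measurable_fun setT f -> (forall u, (0 <= f u)%E) ->
  (\int[gauss s m]_u f u = \int[gauss s m]_u (f (add_tuple w u) *
    (expR (- (\sum_(i < m) tnth w i * tnth u i) / s ^+ 2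
           - (\sum_(i < m) tnth w i ^+ 2) / (s ^+ 2 *+ 2)))%:E))%E.
Proof.
move=> s0; elim: m w f => [|m IH] w f mf f0.
  rewrite [in RHS](eq_integral f) // => u _.
  rewrite !big_ord0 !mul0r oppr0 mul0r addr0 expR0 mule1; congr f.
  by rewrite [RHS]tuple0 [LHS]tuple0.
have mfc : measurable_fun [set: RR * m.-tuple RR] (fun z => f [tuple of z.1 :: z.2]).
  by apply: measurableT_comp => //; exact: measurable_cons_pair.
have mfcx x : measurable_fun [set: m.-tuple RR] (fun z : m.-tuple RR => f [tuple of (x : RR) :: z]).
  by apply: measurableT_comp => //; exact: measurable_cons_tupler.
have mE k (v : k.-tuple R) : measurable_fun [set: k.-tuple RR]
    (fun u : k.-tuple RR => expR (- (\sum_(i < k) tnth v i * tnth u i) / s ^+ 2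
           - (\sum_(i < k) tnth v i ^+ 2) / (s ^+ 2 *+ 2))).
  apply: measurableT_comp => //; apply: measurable_funB => //.
  apply: measurable_funM => //; apply: measurableT_comp => //.
  apply: measurable_sum => i; apply: measurable_funM => //.
  exact: measurable_tnthR.
rewrite [LHS]ge0_integral_iidS// [RHS]ge0_integral_iidS; last first.
- by move=> u; rewrite mule_ge0// lee_fin expR_ge0.
- apply: emeasurable_funM.
    by apply: (measurableT_comp mf); exact: measurable_add_tupler.
  by apply/measurable_EFinP; exact: mE.
have [x0 [w' ->]] : exists x0, exists w' : m.-tuple R, w = [tuple of x0 :: w'].
  by exists (thead w), [tuple of behead w]; exact: tuple_eta.
rewrite (ge0_integral_normal_shift x0)//; last 2 first.
- exact: (@measurable_fun_fubini_tonelli_F _ _ RR (m.-tuple RR) R (gauss s m) _ mfc).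
- by move=> x; exact: integral_ge0.
apply: eq_integral => x _.
rewrite (IH w')//.
rewrite -ge0_integralZr; last first.
- by rewrite lee_fin expR_ge0.
- by move=> u _; rewrite mule_ge0// lee_fin expR_ge0.
- apply: emeasurable_funM.
    by apply: (measurableT_comp (mfcx (x0 + x))); exact: measurable_add_tupler.
  by apply/measurable_EFinP; exact: mE.
- exact: measurableT.
apply: eq_integral => u _; rewrite add_tuple_cons -muleA -EFinM -expRD.
congr (_ * (expR _)%:E)%E.
rewrite !big_ord_recl !tnth0.
under [in RHS]eq_bigr do rewrite !tnthS.
under [X in _ = _ - (_ + X) / _]eq_bigr do rewrite !tnthS.
by field; rewrite gt_eqF.
Qed.

Lemma ge0_integral_gauss_opp (s : R) m (f : m.-tuple RR -> \bar R) :
  0 < s -> measurable_fun setT f -> (forall u, (0 <= f u)%E) ->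
  (\int[gauss s m]_u f u = \int[gauss s m]_u f (opp_tuple u))%E.
Proof.
move=> s0; elim: m f => [|m IH] f mf f0.
  by apply: eq_integral => u _; congr f; rewrite [RHS]tuple0 [LHS]tuple0.
have mfc : measurable_fun [set: RR * m.-tuple RR] (fun z => f [tuple of z.1 :: z.2]).
  by apply: measurableT_comp => //; exact: measurable_cons_pair.
have mfcx x : measurable_fun [set: m.-tuple RR] (fun z : m.-tuple RR => f [tuple of (x : RR) :: z]).
  by apply: measurableT_comp => //; exact: measurable_cons_tupler.
rewrite [LHS]ge0_integral_iidS// [RHS]ge0_integral_iidS; last first.
- by [].
- by apply: (measurableT_comp mf); exact: measurable_opp_tuple.
rewrite ge0_integral_normal_opp; last first.
- by move=> x; exact: integral_ge0.
- exact: (@measurable_fun_fubini_tonelli_F _ _ RR (m.-tuple RR) R (gauss s m) _ mfc).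
- by [].
apply: eq_integral => x _; rewrite IH//.
by apply: eq_integral => u _; rewrite opp_tuple_cons.
Qed.

Lemma ge0_integral_gauss_convolution (a b c : R) m (f : m.-tuple RR -> \bar R) :
  0 < a -> 0 < b -> 0 < c -> c ^+ 2 = a ^+ 2 + b ^+ 2 ->
  measurable_fun setT f -> (forall u, (0 <= f u)%E) ->
  (\int[gauss a m]_u \int[gauss b m]_v f (add_tuple u v) =
   \int[gauss c m]_u f u)%E.
Proof.
move=> a0 b0 c0 cab; elim: m f => [|m IH] f mf f0.
  rewrite (@integral_iid0 _ RR R (normal_prob 0 a) (fun u => \int[gauss b 0]_v f (add_tuple u v))%E).
  rewrite (@integral_iid0 _ RR R (normal_prob 0 b) (fun v => f (add_tuple [tuple] v))).
  rewrite (@integral_iid0 _ RR R (normal_prob 0 c) f).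
  by congr f; exact: tuple0.
have mfc : measurable_fun [set: RR * m.-tuple RR] (fun z => f [tuple of z.1 :: z.2]).
  by apply: measurableT_comp => //; exact: measurable_cons_pair.
have mfcx x : measurable_fun [set: m.-tuple RR] (fun z : m.-tuple RR => f [tuple of (x : RR) :: z]).
  by apply: measurableT_comp => //; exact: measurable_cons_tupler.
have mfa k (g : k.-tuple RR -> \bar R) : measurable_fun setT g ->
    measurable_fun [set: k.-tuple RR * k.-tuple RR] (fun z => g (add_tuple z.1 z.2)).
  by move=> mg; apply: (measurableT_comp mg); exact: measurable_add_tuple.
have mfar k (g : k.-tuple RR -> \bar R) u : measurable_fun setT g ->
    measurable_fun [set: k.-tuple RR] (fun v : k.-tuple RR => g (add_tuple u v)).
  by move=> mg; apply: measurableT_comp => //; exact: measurable_add_tupler.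
rewrite [RHS]ge0_integral_iidS//.
rewrite [LHS]ge0_integral_iidS; last first.
- by move=> u; exact: integral_ge0.
- exact: (@measurable_fun_fubini_tonelli_F _ _ (m.+1.-tuple RR) (m.+1.-tuple RR)
    R (gauss b m.+1) _ (mfa _ _ mf)).
transitivity (\int[normal_prob 0 a]_x \int[normal_prob 0 b]_y
   \int[gauss a m]_u \int[gauss b m]_v f [tuple of (x + y)%R :: add_tuple u v])%E.
  apply: eq_integral => x _.
  transitivity (\int[gauss a m]_u \int[normal_prob 0 b]_y \int[gauss b m]_v
     f [tuple of (x + y)%R :: add_tuple u v])%E.
    apply: eq_integral => u _; rewrite ge0_integral_iidS; [|exact: mfar|by []].
    by apply: eq_integral => y _; apply: eq_integral => v _; rewrite add_tuple_cons.
  pose g (z : m.-tuple RR * RR) := (\int[gauss b m]_v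
     f [tuple of (x + z.2)%R :: add_tuple z.1 v])%E.
  have g0 z : (0 <= g z)%E by exact: integral_ge0.
  have mg : measurable_fun setT g.
    apply: (@measurable_fun_fubini_tonelli_F _ _ (m.-tuple RR * RR)%type (m.-tuple RR)
      R (gauss b m) (fun z => f [tuple of (x + z.1.2) :: add_tuple z.1.1 z.2])) => [|z].
    - apply: (measurableT_comp mf); apply: measurable_cons.
        apply: measurable_funD; first exact: measurable_cst.
        exact: (measurableT_comp measurable_snd measurable_fst).
      apply: measurable_add_tuple; last exact: measurable_snd.
      exact: (measurableT_comp measurable_fst measurable_fst).
    - exact: f0.
  exact: (fubini_tonelli g mg g0).
rewrite -(ge0_integral_normal_convolution a0 b0 c0 cab); last first.
- by move=> x; exact: integral_ge0.
- exact: (@measurable_fun_fubini_tonelli_F _ _ RR (m.-tuple RR) R (gauss c m) _ mfc).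
apply: eq_integral => x _; apply: eq_integral => y _.
exact: (IH (fun u => f [tuple of (x + y)%R :: u])).
Qed.

(** An upper bound for the variance of a linear form. It is an inequality because
    [integral_normal_sqr_le] is one. *)
Lemma integral_gauss_linear_sqr_le (s : R) m (a : 'I_m -> R) : 0 < s ->
  (\int[gauss s m]_u ((\sum_(i < m) a i * tnth u i) ^+ 2)%:E <=
   (s ^+ 2 * \sum_(i < m) a i ^+ 2)%:E)%E.
Proof.
move=> s0.
have mlin k (c : 'I_k -> R) : measurable_fun [set: k.-tuple RR]
    (fun u : k.-tuple RR => \sum_(i < k) c i * tnth u i).
  apply: measurable_sum => i; apply: measurable_funM => //.
  exact: measurable_tnthR.
have mlin2 k (c : 'I_k -> R) : measurable_fun [set: k.-tuple RR]
    (fun u : k.-tuple RR => ((\sum_(i < k) c i * tnth u i) ^+ 2)%:E).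
  by apply/measurable_EFinP; apply: measurable_funX; exact: mlin.
elim: m a => [|m IH] a.
  by rewrite integral_iid0 !big_ord0 expr0n mulr0.
rewrite ge0_integral_iidS; [|exact: mlin2|by move=> u; rewrite lee_fin sqr_ge0].
pose r (u : m.-tuple RR) : R := \sum_(i < m) a (lift ord0 i) * tnth u i.
have mr : measurable_fun [set: m.-tuple RR] r by exact: mlin.
pose g (z : RR * m.-tuple RR) := ((a ord0 * z.1 + r z.2) ^+ 2)%:E.
have g0 z : (0 <= g z)%E by rewrite lee_fin sqr_ge0.
have mg : measurable_fun setT g.
  apply/measurable_EFinP; apply: measurable_funX; apply: measurable_funD.
    by apply: measurable_funM.
  exact: (measurableT_comp mr measurable_snd).
rewrite [X in (X <= _)%E](_ : _ =
    \int[normal_prob 0 s]_x \int[gauss s m]_u g (x, u))%E; last first.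
  apply: eq_integral => x _; apply: eq_integral => u _.
  by rewrite big_ord_recl tnth0; under eq_bigr do rewrite tnthS.
rewrite (fubini_tonelli g mg g0).
(* The first coordinate is integrated with the contribution y of all the others frozen. Only
   nonnegative integrands occur, so the cross term never has to be integrated by itself. *)
have inner (y : R) : (\int[normal_prob 0 s]_x ((a ord0 * x + y) ^+ 2)%:E <=
    (s ^+ 2 * a ord0 ^+ 2)%:E + (y ^+ 2)%:E)%E.
  have mq (c : R) : measurable_fun [set: R] (fun x : R => ((c * x + y) ^+ 2)%:E).
    apply/measurable_EFinP; apply: measurable_funX; apply: measurable_funD => //.
  have q0 (c x : R) : (0 <= ((c * x + y) ^+ 2)%:E)%E by rewrite lee_fin sqr_ge0.
  set I := (\int[_]_x _)%E.
  have I0 : (0 <= I)%E by apply: integral_ge0 => x _; exact: q0.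
  (* By symmetry the cross term may be dropped. *)
  have II : (I + I <= (2 * (s ^+ 2 * a ord0 ^+ 2 + y ^+ 2))%:E)%E.
    have -> : (I + I = \int[normal_prob 0 s]_x
        ((2 * a ord0 ^+ 2)%:E * (x ^+ 2)%:E + (2 * y ^+ 2)%:E))%E.
      have mqN : measurable_fun [set: R] (fun x => ((a ord0 * - x + y) ^+ 2)%:E).
        by under eq_fun do rewrite mulrN -mulNr; exact: mq.
      have EI : I = (\int[normal_prob 0 s]_x ((a ord0 * - x + y) ^+ 2)%:E)%E.
        exact: (ge0_integral_normal_opp s0 (mq (a ord0)) (q0 (a ord0))).
      rewrite {2}EI /I -ge0_integralD; last first.
      - exact: mqN.
      - by move=> x _; rewrite lee_fin sqr_ge0.
      - exact: mq.
      - by move=> x _; exact: q0.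
      - exact: measurableT.
      by apply: eq_integral => x _; rewrite -EFinD -EFinM -EFinD; congr EFin; ring.
    have mx2 : measurable_fun [set: R] (fun x : R => (x ^+ 2)%:E).
      by apply/measurable_EFinP; exact: measurable_funX.
    have a20 : 0 <= 2 * a ord0 ^+ 2 by rewrite mulr_ge0 ?sqr_ge0.
    have y20 : 0 <= 2 * y ^+ 2 by rewrite mulr_ge0 ?sqr_ge0.
    rewrite ge0_integralD; last first.
    - exact: measurable_cst.
    - by move=> x _; rewrite lee_fin.
    - exact: measurable_funeM.
    - by move=> x _; rewrite -EFinM lee_fin mulr_ge0 ?sqr_ge0.
    - exact: measurableT.
    rewrite integral_cst; last exact: measurableT.
    rewrite [X in (_ * X)%E]probability_setT mule1.
    rewrite ge0_integralZl; last first.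
    - by rewrite lee_fin.
    - by move=> x _; rewrite lee_fin sqr_ge0.
    - exact: mx2.
    - exact: measurableT.
    rewrite (_ : 2 * (s ^+ 2 * a ord0 ^+ 2 + y ^+ 2) =
      2 * a ord0 ^+ 2 * s ^+ 2 + 2 * y ^+ 2); last by ring.
    rewrite [X in (_ <= X)%E]EFinD leeD2r// [X in (_ <= X)%E]EFinM.
    by apply: lee_wpmul2l; [rewrite lee_fin|exact: integral_normal_sqr_le].
  move: I0 II; case: I => [v|//|//] _; rewrite -!EFinD !lee_fin; lra.
apply: (@le_trans _ _ (\int[gauss s m]_u ((s ^+ 2 * a ord0 ^+ 2)%:E + (r u ^+ 2)%:E))%E).
  apply: ge0_le_integral => //.
  - by move=> u _; apply: integral_ge0 => x _; exact: g0.
  - exact: (@measurable_fun_fubini_tonelli_G _ _ RR (m.-tuple RR) R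
      (normal_prob 0 s) g mg g0).
  - by apply: emeasurable_funD => //; exact: mlin2.
  - by move=> u _; rewrite /g /=; exact (inner (r u)).
rewrite ge0_integralD; last first.
- exact: mlin2.
- by move=> u _; rewrite lee_fin sqr_ge0.
- exact: measurable_cst.
- by move=> u _; rewrite lee_fin mulr_ge0 ?sqr_ge0.
- exact: measurableT.
rewrite integral_cst// [X in (_ * X)%E]probability_setT mule1.
by rewrite big_ord_recl mulrDr EFinD leeD2l// IH.
Qed.

End gaussian_tuple.

(** * Lipschitz functions and Gaussian averages *)

Section l1_lipschitz.
Context {R : realType} {m : nat}.
Local Notation RR := (measurableTypeR R).
Implicit Types (phi psi : 'rV[R]_m -> R) (A B : R) (v w : 'rV[R]_m).

Definition l1 v : R := \sum_i `|v 0 i|.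

(** The l1 norm splits over the coordinates, which reduces integrability under a Gaussian to one
    coordinate at a time. The constant serves only measurability and integrability; the quantitative
    bounds are carried by separate hypotheses. *)
Definition l1_lipschitz A phi :=
  forall v w, `|phi v - phi w| <= A * l1 (v - w).

Lemma l1_ge0 v : 0 <= l1 v.
Proof. by apply: sumr_ge0. Qed.

Lemma l1N v : l1 (- v) = l1 v.
Proof. by apply: eq_bigr => i _; rewrite mxE normrN. Qed.

Lemma l1_lipschitz_weaken A phi : l1_lipschitz A phi -> l1_lipschitz `|A| phi.
Proof.
by move=> h v w; apply: le_trans (h v w) _; rewrite ler_wpM2r ?l1_ge0 ?ler_norm.
Qed.

Lemma l1_lipschitz_cst (k : R) : l1_lipschitz 0 (fun=> k).
Proof. by move=> v w; rewrite subrr normr0 mul0r. Qed.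

Lemma l1_lipschitz_shift A phi w :
  l1_lipschitz A phi -> l1_lipschitz A (fun v => phi (w + v)).
Proof.
by move=> h u v; apply: le_trans (h _ _) _; rewrite opprD addrACA subrr add0r.
Qed.

Lemma l1_lipschitz_opp A phi :
  l1_lipschitz A phi -> l1_lipschitz A (fun v => phi (- v)).
Proof.
by move=> h u v; apply: le_trans (h _ _) _; rewrite -opprD l1N.
Qed.

Lemma l1_lipschitzD A B phi psi : l1_lipschitz A phi -> l1_lipschitz B psi ->
  l1_lipschitz (A + B) (fun v => phi v + psi v).
Proof.
move=> h1 h2 u v; rewrite opprD addrACA (le_trans (ler_normD _ _))//.
by rewrite mulrDl lerD.
Qed.

Lemma l1_lipschitzZ A (k : R) phi : l1_lipschitz A phi ->
  l1_lipschitz (`|k| * A) (fun v => k * phi v).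
Proof.
by move=> h u v; rewrite -mulrBr normrM -mulrA ler_wpM2l.
Qed.

Lemma l1_lipschitzB A B phi psi : l1_lipschitz A phi -> l1_lipschitz B psi ->
  l1_lipschitz (A + B) (fun v => phi v - psi v).
Proof.
move=> h1 h2 u v.
rewrite (_ : _ - _ = (phi u - phi v) - (psi u - psi v)); last by ring.
by rewrite (le_trans (ler_normB _ _))// mulrDl lerD.
Qed.

Lemma l1_lipschitz_sum n A (phi : 'I_n -> 'rV[R]_m -> R) :
  (forall i, l1_lipschitz A (phi i)) ->
  l1_lipschitz (n%:R * A) (fun v => \sum_(i < n) phi i v).
Proof.
move=> h u v; rewrite -sumrB (le_trans (ler_norm_sum _ _ _))//.
rewrite (le_trans (ler_sum _ (fun i _ => h i u v)))//.
by rewrite sumr_const card_ord -mulrA mulr_natl.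
Qed.

Lemma l1_lipschitz_max0 A phi : l1_lipschitz A phi ->
  l1_lipschitz A (fun v => Num.max (phi v) 0).
Proof.
move=> h u v; apply: le_trans (h u v); move: (phi u) (phi v) => a b.
have h1 := ler_norm (a - b); have h2 := ler_norm (b - a).
rewrite distrC in h2; have h3 := normr_ge0 (a - b).
by rewrite /Num.max ler_norml; case: ifPn; case: ifPn; rewrite -?leNgt;
  move=> ? ?; apply/andP; split; lra.
Qed.

Definition row_of (u : m.-tuple R) : 'rV[R]_m := \row_i tnth u i.

Lemma row_of_add (u v : m.-tuple R) : row_of (add_tuple u v) = row_of u + row_of v.
Proof. by apply/rowP => i; rewrite !mxE tnth_mktuple. Qed.

Lemma row_of_opp (u : m.-tuple R) : row_of (opp_tuple u) = - row_of u.
Proof. by apply/rowP => i; rewrite !mxE tnth_mktuple. Qed.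

Lemma row_ofK v : row_of [tuple v 0 i | i < m] = v.
Proof. by apply/rowP => i; rewrite !mxE tnth_mktuple. Qed.

Let grid (k : nat) (u : m.-tuple R) : m.-tuple int :=
  [tuple Num.floor (tnth u i * k.+1%:R) | i < m].

Let point (k : nat) (c : m.-tuple int) : 'rV[R]_m := \row_i ((tnth c i)%:~R / k.+1%:R).

Let l1_point_grid (k : nat) u : l1 (row_of u - point k (grid k u)) <= m%:R / k.+1%:R.
Proof.
rewrite (le_trans (ler_sum _ (G := fun=> k.+1%:R^-1) _))//.
  move=> i _; rewrite !mxE tnth_mktuple.
  have k0 : 0 < k.+1%:R :> R by [].
  have /andP[h1 h2] := floor_itv (tnth u i * k.+1%:R).
  rewrite intrD in h2.
  rewrite ger0_norm; last by rewrite subr_ge0 ler_pdivrMr.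
  by rewrite lerBlDl -{2}[_^-1]mul1r -mulrDl ler_pdivlMr// ltW.
by rewrite sumr_const card_ord mulr_natl.
Qed.

Let measurable_grid (k : nat) c : measurable [set u : m.-tuple RR | grid k u = c].
Proof.
rewrite (_ : [set u : m.-tuple RR | _] = \bigcap_(i in [set: 'I_m])
   ((fun u : m.-tuple RR => tnth u i * k.+1%:R : R) @^-1`
     `[(tnth c i)%:~R, (tnth c i + 1)%:~R[%classic)).
  apply: fin_bigcap_measurable => // i _.
  have mi : measurable_fun [set: m.-tuple RR]
      (fun u : m.-tuple RR => tnth u i * k.+1%:R : R).
    by apply: measurable_funM => //; exact: measurable_tnthR.
  by rewrite -[X in measurable X]setTI; exact: mi.
apply/seteqP; split=> u /=.
  move=> <- i _ /=; rewrite in_itv/= tnth_mktuple.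
  exact: floor_itv.
move=> h; apply: eq_from_tnth => i; rewrite tnth_mktuple.
have := h i I; rewrite /= in_itv/= => /floor_def.
by [].
Qed.

(* A Caratheodory function is the pointwise limit of its evaluations on finer
   and finer countable grids. *)
Lemma measurable_caratheodory d (T : measurableType d) (F : 'rV[R]_m -> T -> R) :
  (forall p, exists A, l1_lipschitz A (F ^~ p)) ->
  (forall v, measurable_fun setT (F v)) ->
  measurable_fun [set: T * m.-tuple RR] (fun z => F (row_of z.2) z.1).
Proof.
move=> lF mF.
apply: (@measurable_fun_cvg _ (T * m.-tuple RR)%type R setT
  (fun k z => F (point k (grid k z.2)) z.1)).
  move=> k _ B mB; rewrite setTI.
  (* On a cell of the grid the approximation depends on the point of [T] alone, so a preimage is a
     countable union of measurable rectangles. *)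
  rewrite (_ : _ @^-1` _ = \bigcup_(c in [set: m.-tuple int])
    ((F (point k c) @^-1` B) `*` [set u : m.-tuple RR | grid k u = c])).
    apply: countable_bigcupT_measurable => [|c]; first exact: countableP.
    apply: measurableX; last exact: measurable_grid.
    by rewrite -[X in measurable X]setTI; exact: mF.
  apply/seteqP; split => -[p u] /=; first by move=> h; exists (grid k u).
  by move=> [c _ [/= h ->]].
move=> [p u] _ /=; have [A lA] := lF p.
apply/cvgrPdist_le => e e0.
have : (fun k => `|A| * m%:R * k.+1%:R^-1) @ \oo --> (0 : R).
  by rewrite -[X in _ --> X](mulr0 (`|A| * m%:R)); apply: cvgMr; exact: cvg_harmonic.
move/cvgrPdist_le => /(_ e e0); apply: filterS => k /=.
rewrite sub0r normrN ger0_norm// => h.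
rewrite (le_trans (l1_lipschitz_weaken lA _ _))// (le_trans _ h)//.
by rewrite -mulrA ler_wpM2l// l1_point_grid.
Qed.

Lemma measurable_l1_lipschitz A phi : l1_lipschitz A phi ->
  measurable_fun [set: m.-tuple RR] (fun u : m.-tuple RR => phi (row_of u)).
Proof.
move=> lphi.
have mphi := @measurable_caratheodory _ (m.-tuple RR) (fun v _ => phi v)
  (fun=> ex_intro _ A lphi) (fun v => measurable_cst (phi v)).
exact: (measurableT_comp mphi
  (pair1_measurable (nseq_tuple m (0 : R) : m.-tuple RR))).
Qed.

End l1_lipschitz.

(** * Gaussian averages and change of measure *)

Section gauss_mean.
Context {R : realType} {m : nat}.
Local Notation RR := (measurableTypeR R).
Local Notation gauss s := (iid_probability (normal_prob (0 : R) s) m).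
Implicit Types (phi psi : 'rV[R]_m -> R) (A B s : R) (v w : 'rV[R]_m).

Definition gauss_mean s phi : R := (\int[gauss s]_u phi (row_of u))%R.

Lemma integrable_tnth_sqr s (i : 'I_m) : 0 < s ->
  (gauss s).-integrable setT (fun u => (tnth u i ^+ 2)%:E).
Proof.
move=> s0; apply/integrableP; split.
  by apply/measurable_EFinP; apply: measurable_funX; exact: measurable_tnthR.
apply: (@le_lt_trans _ _ (s ^+ 2)%:E); last by rewrite ltry.
have := @integral_gauss_linear_sqr_le R s m (fun j => (j == i)%:R) s0.
rewrite (bigD1 i)//= eqxx expr1n big1 ?addr0 ?mulr1; last first.
  by move=> j /negbTE ->; rewrite expr0n.
apply: le_trans; rewrite le_eqVlt; apply/orP; left; apply/eqP.
apply: eq_integral => u _; rewrite /= ger0_norm ?sqr_ge0//; congr (_ ^+ 2)%:E.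
rewrite (bigD1 i)//= eqxx mul1r big1 ?addr0// => j /negbTE ->.
by rewrite mul0r.
Qed.

Lemma integrable_gauss_cst s (k : R) : (gauss s).-integrable setT (fun=> k%:E).
Proof. exact: finite_measure_integrable_cst. Qed.

(** Domination by |phi 0| + |A| sum_i (1 + u_i^2), using |x| <= 1 + x^2. *)
Lemma integrable_gauss_lipschitz s A phi : 0 < s -> l1_lipschitz A phi ->
  (gauss s).-integrable setT (fun u => (phi (row_of u))%:E).
Proof.
move=> s0 lphi.
have h : (gauss s).-integrable setT
    (fun u => (`|phi 0|%:E + \sum_(i < m) (`|A|%:E + `|A|%:E * (tnth u i ^+ 2)%:E))%E).
  apply: integrableD => //; first exact: integrable_gauss_cst.
  apply: integrable_sum => //= i _; apply: integrableD => //.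
    exact: integrable_gauss_cst.
  by apply: integrableZl => //; exact: integrable_tnth_sqr.
apply: le_integrable h => //.
  by apply/measurable_EFinP; exact: measurable_l1_lipschitz lphi.
move=> u _ /=.
under eq_bigr do rewrite -EFinM -EFinD.
rewrite sumEFin -EFinD /= lee_fin [leRHS]ger0_norm; last first.
  by rewrite addr_ge0// sumr_ge0// => i _; rewrite addr_ge0// mulr_ge0// sqr_ge0.
rewrite -[phi _](subrK (phi 0)) addrC (le_trans (ler_normD _ _))// lerD2l.
rewrite (le_trans (l1_lipschitz_weaken lphi _ _))// subr0 mulr_sumr ler_sum// => i _.
rewrite -[X in _ <= X + _]mulr1 -mulrDr ler_wpM2l// mxE.
have := sqr_ge0 (`|tnth u i| - 1).
rewrite sqrrB1 real_normK ?num_real//.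
have := normr_ge0 (tnth u i); lra.
Qed.

Lemma gauss_meanE s A phi : 0 < s -> l1_lipschitz A phi ->
  (gauss_mean s phi)%:E = (\int[gauss s]_u (phi (row_of u))%:E)%E.
Proof.
move=> s0 lphi; rewrite /gauss_mean /Rintegral fineK//.
by apply: integrable_fin_num => //; exact: integrable_gauss_lipschitz lphi.
Qed.

Lemma gauss_mean_cst s (k : R) : gauss_mean s (fun=> k) = k.
Proof.
rewrite /gauss_mean Rintegral_cst//; set P := (X in fine X).
by rewrite (_ : P = 1%E) ?mulr1//; exact: probability_setT.
Qed.

Lemma gauss_meanD s A B phi psi : 0 < s ->
  l1_lipschitz A phi -> l1_lipschitz B psi ->
  gauss_mean s (fun v => phi v + psi v) = gauss_mean s phi + gauss_mean s psi.
Proof.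
move=> s0 h1 h2; apply: RintegralD => //; exact: integrable_gauss_lipschitz.
Qed.

Lemma gauss_meanB s A B phi psi : 0 < s ->
  l1_lipschitz A phi -> l1_lipschitz B psi ->
  gauss_mean s (fun v => phi v - psi v) = gauss_mean s phi - gauss_mean s psi.
Proof.
move=> s0 h1 h2; apply: RintegralB => //; exact: integrable_gauss_lipschitz.
Qed.

Lemma gauss_meanZ s A (k : R) phi : 0 < s -> l1_lipschitz A phi ->
  gauss_mean s (fun v => k * phi v) = k * gauss_mean s phi.
Proof.
move=> s0 h1; apply: RintegralZl => //; exact: integrable_gauss_lipschitz h1.
Qed.

Lemma gauss_mean_sum n s A (phi : 'I_n -> 'rV[R]_m -> R) : 0 < s ->
  (forall i, l1_lipschitz A (phi i)) ->
  gauss_mean s (fun v => \sum_(i < n) phi i v) = \sum_(i < n) gauss_mean s (phi i).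
Proof.
move=> s0; elim: n phi => [|n IH] phi lphi.
  rewrite big_ord0 -[RHS](gauss_mean_cst s 0).
  by congr gauss_mean; apply/funext => v; rewrite big_ord0.
rewrite big_ord_recl -IH//.
rewrite -(@gauss_meanD s A (n%:R * A))//; last exact: l1_lipschitz_sum.
by congr gauss_mean; apply/funext => v; rewrite big_ord_recl.
Qed.

Lemma le_gauss_mean s A B phi psi : 0 < s ->
  l1_lipschitz A phi -> l1_lipschitz B psi -> (forall v, phi v <= psi v) ->
  gauss_mean s phi <= gauss_mean s psi.
Proof.
move=> s0 h1 h2 h; apply: le_Rintegral => //.
- exact: integrable_gauss_lipschitz h1.
- exact: integrable_gauss_lipschitz h2.
Qed.

Lemma l1_lipschitz_gauss_mean s A phi : 0 < s -> l1_lipschitz A phi ->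
  l1_lipschitz A (fun v => gauss_mean s (fun u => phi (v + u))).
Proof.
move=> s0 h.
have le v w : gauss_mean s (fun u => phi (v + u)) <=
    A * l1 (v - w) + gauss_mean s (fun u => phi (w + u)).
  rewrite -[X in _ <= X + _](gauss_mean_cst s) -(gauss_meanD s0 (l1_lipschitz_cst _) (l1_lipschitz_shift w h)).
  apply: (le_gauss_mean s0 (l1_lipschitz_shift v h)
    (l1_lipschitzD (l1_lipschitz_cst _) (l1_lipschitz_shift w h))) => u.
  rewrite -lerBlDr (le_trans (ler_norm _))// (le_trans (h _ _))//.
  by rewrite opprD addrACA subrr addr0.
move=> v w; rewrite ler_norml lerBlDr le andbT lerNl opprB lerBlDr.
by rewrite (le_trans (le w v))// -opprB l1N.
Qed.

Lemma gauss_mean_opp s A phi : 0 < s -> l1_lipschitz A phi ->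
  gauss_mean s (fun v => phi (- v)) = gauss_mean s phi.
Proof.
move=> s0.
(* The transformation rules for integrals are stated for nonnegative integrands. Positive and
   negative parts of a Lipschitz function are again Lipschitz, so the general case follows by
   subtraction. *)
have nneg psi : l1_lipschitz A psi -> (forall v, 0 <= psi v) ->
    gauss_mean s (fun v => psi (- v)) = gauss_mean s psi.
  move=> h psi0; apply: EFin_inj.
  rewrite [RHS](gauss_meanE s0 h) [LHS](gauss_meanE s0 (l1_lipschitz_opp h)).
  have mpsi : measurable_fun [set: m.-tuple RR] (fun u => (psi (row_of u))%:E).
    by apply/measurable_EFinP; exact: measurable_l1_lipschitz h.
  rewrite [RHS](ge0_integral_gauss_opp s0 mpsi); last by move=> u; rewrite lee_fin.
  by apply: eq_integral => u _; rewrite row_of_opp.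
move=> h.
have hp := l1_lipschitz_max0 h.
have hN : l1_lipschitz A (fun v => - phi v).
  by move=> v w; rewrite -opprD normrN; exact: h.
have hn := l1_lipschitz_max0 hN.
have phiE v : phi v = Num.max (phi v) 0 - Num.max (- phi v) 0.
  by rewrite /Num.max; case: ltP => ?; case: ltP => ?; lra.
transitivity (gauss_mean s (fun v => Num.max (phi v) 0) -
   gauss_mean s (fun v => Num.max (- phi v) 0)); last first.
  by rewrite -(gauss_meanB s0 hp hn); congr gauss_mean; apply/funext => v.
rewrite -(nneg _ hp) => [|v]; last by rewrite le_max lexx orbT.
rewrite -(nneg _ hn) => [|v]; last by rewrite le_max lexx orbT.
rewrite -(gauss_meanB s0 (l1_lipschitz_opp hp) (l1_lipschitz_opp hn)).
by congr gauss_mean; apply/funext => v.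
Qed.

Lemma gauss_mean_convolution a b c A phi : 0 < a -> 0 < b -> 0 < c ->
  c ^+ 2 = a ^+ 2 + b ^+ 2 -> l1_lipschitz A phi ->
  gauss_mean a (fun u => gauss_mean b (fun v => phi (u + v))) = gauss_mean c phi.
Proof.
move=> a0 b0 c0 cab.
have nneg psi : l1_lipschitz A psi -> (forall v, 0 <= psi v) ->
    gauss_mean a (fun u => gauss_mean b (fun v => psi (u + v))) = gauss_mean c psi.
  move=> h psi0; apply: EFin_inj.
  rewrite [RHS](gauss_meanE c0 h) [LHS](gauss_meanE a0 (l1_lipschitz_gauss_mean b0 h)).
  have mpsi : measurable_fun [set: m.-tuple RR] (fun u => (psi (row_of u))%:E).
    by apply/measurable_EFinP; exact: measurable_l1_lipschitz h.
  rewrite -[RHS](ge0_integral_gauss_convolution a0 b0 c0 cab mpsi); last first.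
    by move=> u; rewrite lee_fin.
  apply: eq_integral => u _; rewrite (gauss_meanE b0 (l1_lipschitz_shift _ h)).
  by apply: eq_integral => v _; rewrite row_of_add.
move=> h.
have hp := l1_lipschitz_max0 h.
have hN : l1_lipschitz A (fun v => - phi v).
  by move=> v w; rewrite -opprD normrN; exact: h.
have hn := l1_lipschitz_max0 hN.
have phiE v : phi v = Num.max (phi v) 0 - Num.max (- phi v) 0.
  by rewrite /Num.max; case: ltP => ?; case: ltP => ?; lra.
transitivity (gauss_mean c (fun v => Num.max (phi v) 0) -
   gauss_mean c (fun v => Num.max (- phi v) 0)); last first.
  by rewrite -(gauss_meanB c0 hp hn); congr gauss_mean; apply/funext => v.
rewrite -(nneg _ hp) => [|v]; last by rewrite le_max lexx orbT.
rewrite -(nneg _ hn) => [|v]; last by rewrite le_max lexx orbT.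
rewrite -(gauss_meanB a0 (l1_lipschitz_gauss_mean b0 hp) (l1_lipschitz_gauss_mean b0 hn)).
congr gauss_mean; apply/funext => u.
rewrite -(gauss_meanB b0 (l1_lipschitz_shift u hp) (l1_lipschitz_shift u hn)).
by congr gauss_mean; apply/funext => v.
Qed.

Definition sqn v : R := \sum_i v 0 i ^+ 2.

Lemma l1_lipschitz_linear v :
  exists A, l1_lipschitz A (fun u => \sum_i v 0 i * u 0 i).
Proof.
exists (l1 v) => u w.
rewrite -sumrB; under eq_bigr do rewrite -mulrBr.
rewrite (le_trans (ler_norm_sum _ _ _))// [leRHS]mulr_sumr ler_sum// => i _.
rewrite normrM !mxE ler_wpM2r//.
by rewrite /l1 (bigD1 i)//= lerDl sumr_ge0.
Qed.

Lemma gauss_mean_linear s v : 0 < s ->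
  gauss_mean s (fun u => \sum_i v 0 i * u 0 i) = 0.
Proof.
move=> s0; have [A h] := l1_lipschitz_linear v.
have := gauss_mean_opp s0 h.
have -> : (fun u : 'rV[R]_m => \sum_i v 0 i * (- u) 0 i) =
    (fun u => -1 * \sum_i v 0 i * u 0 i).
  apply/funext => u; rewrite mulr_sumr; apply: eq_bigr => i _.
  by rewrite !mxE; ring.
rewrite (gauss_meanZ _ s0 h); lra.
Qed.

(* Donsker-Varadhan inequality between N(w, s^2 I) and N(0, s^2 I), whose
   relative entropy is |w|^2 / (2 s^2). *)
Lemma gauss_donsker_varadhan s A phi w : 0 < s -> l1_lipschitz A phi ->
  ((expR (gauss_mean s (fun u => phi (w + u)) - sqn w / (s ^+ 2 *+ 2)))%:E <=
   \int[gauss s]_u (expR (phi (row_of u)))%:E)%E.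
Proof.
move=> s0 h.
have mexp psi B : l1_lipschitz B psi ->
    measurable_fun [set: m.-tuple RR] (fun u => (expR (psi (row_of u)))%:E).
  move=> hpsi; apply/measurable_EFinP; apply: measurableT_comp => //.
  exact: measurable_l1_lipschitz hpsi.
(* After the shift by w the integrand exp(phi) becomes exp(psi): the subtracted term is minus the
   logarithm of the density ratio. Its linear part has mean 0, so psi has mean a, the exponent on
   the left-hand side. *)
pose psi u := phi (w + u) - (s ^- 2 * (\sum_i w 0 i * u 0 i) + sqn w / (s ^+ 2 *+ 2)).
have [B hB] := l1_lipschitz_linear w.
have hw := l1_lipschitz_shift w h.
have hc := l1_lipschitz_cst (sqn w / (s ^+ 2 *+ 2)) : l1_lipschitz 0 (fun _ : 'rV[R]_m => _).
have hlin := l1_lipschitzD (l1_lipschitzZ (s ^- 2) hB) hc.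
have hpsi := l1_lipschitzB hw hlin.
have expR0' (f : m.-tuple RR -> R) u : (0 <= (expR (f u))%:E)%E by rewrite lee_fin expR_ge0.
have -> : (\int[gauss s]_u (expR (phi (row_of u)))%:E =
    \int[gauss s]_u (expR (psi (row_of u)))%:E)%E.
  rewrite (ge0_integral_gauss_shift [tuple w 0 i | i < m] s0 (mexp _ _ h)); last first.
    exact: (expR0' (fun u => phi (row_of u))).
  apply: eq_integral => u _; rewrite -EFinM -expRD; congr (expR _)%:E.
  rewrite row_of_add row_ofK /psi; congr (_ + _).
  rewrite /sqn opprD mulNr [in RHS]mulrC; congr (- (_ * _) - _ * _).
    by apply: eq_bigr => i _; rewrite tnth_mktuple mxE.
  by apply: eq_bigr => i _; rewrite tnth_mktuple.
set a := _ - _.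
have psia : gauss_mean s psi = a.
  rewrite (gauss_meanB s0 hw hlin) (gauss_meanD s0 (l1_lipschitzZ _ hB) hc).
  by rewrite (gauss_meanZ _ s0 hB) gauss_mean_linear// mulr0 add0r gauss_mean_cst.
have [->|/eqP fin] := eqVneq (\int[gauss s]_u (expR (psi (row_of u)))%:E)%E +oo%E.
  by rewrite leey.
have iexp : (gauss s).-integrable setT (fun u => (expR (psi (row_of u)))%:E).
  apply/integrableP; split; first exact: mexp hpsi.
  apply: (@le_lt_trans _ _ (\int[gauss s]_u (expR (psi (row_of u)))%:E)%E).
    rewrite le_eqVlt; apply/orP; left; apply/eqP; apply: eq_integral => u _ /=.
    by rewrite ger0_norm ?expR_ge0.
  by rewrite ltey; apply/eqP.
(* Jensen's inequality through the tangent of exp at the mean: exp(a) (1 + y - a) <= exp(y),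
   integrated at y = psi(u). *)
have haff := l1_lipschitzD (l1_lipschitzZ (expR a) hpsi)
  (l1_lipschitz_cst (expR a * (1 - a))).
have -> : expR a = gauss_mean s (fun u => expR a * psi u + expR a * (1 - a)).
  rewrite (gauss_meanD s0 (l1_lipschitzZ _ hpsi) (l1_lipschitz_cst _)).
  rewrite (gauss_meanZ _ s0 hpsi) gauss_mean_cst psia; ring.
rewrite (gauss_meanE s0 haff).
apply: le_integral => //; first exact: integrable_gauss_lipschitz haff.
move=> u _; rewrite lee_fin -mulrDr -/(psi (row_of u)).
move: (psi (row_of u)) => y; move: (a) => b.
have h1 := expR_ge1Dx (y - b).
rewrite -[in leRHS](subrK b y) [in leRHS]addrC expRD ler_wpM2l ?expR_ge0//; lra.
Qed.

End gauss_mean.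

(** * Hoeffding's inequality *)

Section hoeffding.
Context {R : realType}.

Lemma is_derive_ge0_le (f df : R -> R) (t : R) : 0 <= t ->
  (forall x : R, is_derive x (1 : R) f (df x)) -> (forall x, 0 <= x -> 0 <= df x) ->
  f 0 <= f t.
Proof.
rewrite le_eqVlt => /predU1P[<-//|t0] hd h0.
have cf : {within `[0, t], continuous f}.
  by apply: derivable_within_continuous => x _; have [] := hd x.
have [c] := MVT t0 (fun x _ => hd x) cf.
rewrite in_itv/= => /andP[c0 _] E.
by rewrite -subr_ge0 E subr0 mulr_ge0 ?h0 ?ltW.
Qed.

Lemma expR_chord (p q a b : R) : 0 <= p -> 0 <= q -> p + q = 1 ->
  expR (p * a + q * b) <= p * expR a + q * expR b.
Proof.
(* Jensen again: the tangent at c = p a + q b is averaged over a and b. *)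
have tangent (c x : R) : expR c * (1 + (x - c)) <= expR x.
  by rewrite -[in leRHS](subrK c x) [in leRHS]addrC expRD ler_wpM2l ?expR_ge0// expR_ge1Dx.
move=> p0 q0 pq; set c := p * a + q * b.
have ha := tangent c a; have hb := tangent c b.
apply: le_trans (lerD (ler_wpM2l p0 ha) (ler_wpM2l q0 hb)).
rewrite le_eqVlt; apply/orP; left; apply/eqP.
rewrite (_ : q = 1 - p); last by lra.
rewrite /c (_ : q = 1 - p); last by lra.
by ring.
Qed.

(* The logarithm of the left-hand side has second derivative at most 1. *)
Lemma hoeffding_two_point (p q t : R) : 0 <= p -> 0 <= q -> p + q = 1 -> 0 <= t ->
  p * expR t + q * expR (- t) <= expR ((p - q) * t + t ^+ 2 / 2).
Proof.
move=> p0 q0 pq t0.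
pose D (x : R) := p * expR x + q * expR (- x).
pose N (x : R) := p * expR x - q * expR (- x).
have D0 x : 0 < D x.
  have [p1|p1] := ltP 0 p.
    by rewrite ltr_pwDl ?mulr_gt0 ?expR_gt0// mulr_ge0 ?expR_ge0.
  by rewrite ltr_wpDl ?mulr_ge0 ?expR_ge0// mulr_gt0 ?expR_gt0//; lra.
have N00 : N 0 = p - q by rewrite /N oppr0 expR0 !mulr1.
have D00 : D 0 = 1 by rewrite /D oppr0 expR0 !mulr1.
have dexpN (x : R) : is_derive x (1 : R) (fun y => expR (- y)) (- expR (- x)).
  have -> : - expR (- x) = expR (- x) * (- 1) by rewrite mulrN1.
  exact: (@is_derive1_comp _ expR -%R).
have dD x : is_derive x (1 : R) D (N x).
  rewrite /N -mulrN.
  by apply: is_deriveD.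
have dN x : is_derive x (1 : R) N (D x).
  rewrite /D -[q * _]opprK -mulrN.
  by apply: is_deriveB.
(* [N / D] is the derivative of [ln D], and the derivative displayed here simplifies to (N / D)^2 >=
   0. This function vanishes at 0, hence is nonnegative for x >= 0; it is itself the derivative of
   the gap in the claim after taking logarithms, which also vanishes at 0. *)
have dr x : is_derive x (1 : R) (fun y => (p - q + y) - N y / D y)
    (1 - (D x ^+ 2 - N x ^+ 2) / D x ^+ 2).
  have Dx0 : D x != 0 by rewrite gt_eqF.
  have dV := @is_deriveV R D x (N x) 1 Dx0 (dD x).
  have dM : is_derive x (1 : R) (fun y => N y / D y) _ :=
    @is_deriveM R R N (fun y => (D y)^-1) x 1 _ _ (dN x) dV.
  have dl : is_derive x (1 : R) (fun y : R => p - q + y) 1.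
    by rewrite -[X in is_derive _ _ _ X]add0r; exact: is_deriveD.
  apply: (is_derive_eq (is_deriveB dl dM)).
  by rewrite -!/(_ * _) /GRing.scale/=; field.
have r0 x : 0 <= x -> 0 <= (p - q + x) - N x / D x.
  move=> x0; have := is_derive_ge0_le x0 dr.
  rewrite /= N00 D00 divr1 addr0 subrr; apply => y _.
  rewrite subr_ge0 ler_pdivrMr ?exprn_gt0// mul1r lerBlDr lerDl sqr_ge0//.
have dh x : is_derive x (1 : R) (fun y => (p - q) * y + y ^+ 2 / 2 - ln (D y))
   ((p - q + x) - N x / D x).
  have dln : is_derive x (1 : R) (fun y => ln (D y)) ((D x)^-1 * N x).
    exact: (@is_derive1_comp _ (@ln R) D x _ _ (is_derive1_ln (D0 x)) (dD x)).
  have dq : is_derive x (1 : R) (fun y : R => (p - q) * y + y ^+ 2 / 2) (p - q + x).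
    apply: is_derive_eq.
    by rewrite /GRing.scale/=; field.
  apply: (is_derive_eq (is_deriveB dq dln)).
  by rewrite mulrC.
have := is_derive_ge0_le t0 dh r0.
rewrite /= D00 mulr0 expr0n/= mul0r addr0 ln1 subr0.
rewrite subr_ge0 -ler_expR lnK//; exact: D0.
Qed.
End hoeffding.

Section moment_generating.
Context {d : measure_display} {T : measurableType d} {R : realType}.
Variable P : probability T R.
Implicit Types (X : T -> R) (B k : R).

Lemma integrable_bounded X B : measurable_fun setT X -> (forall x, `|X x| <= B) ->
  P.-integrable setT (EFin \o X).
Proof.
move=> mX bX; apply: (@le_integrable _ _ _ _ _ measurableT _ (fun=> B%:E)).
- exact/measurable_EFinP.
- by move=> x _ /=; rewrite lee_fin (le_trans (bX x))// ler_norm.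
- exact: finite_measure_integrable_cst.
Qed.

Lemma Rintegral_probability_cst k : (\int[P]_x k)%R = k.
Proof.
rewrite Rintegral_cst//; set p := (X in fine X).
by rewrite (_ : p = 1%E) ?mulr1//; exact: probability_setT.
Qed.

Lemma normr_Rintegral_le X B : measurable_fun setT X -> (forall x, `|X x| <= B) ->
  `|(\int[P]_x X x)%R| <= B.
Proof.
move=> mX bX; have iX := integrable_bounded mX bX.
rewrite (le_trans (le_normr_Rintegral _ iX))// -[leRHS]Rintegral_probability_cst.
apply: le_Rintegral => //.
- by apply: (integrable_norm iX).
- exact: finite_measure_integrable_cst.
Qed.

(** By convexity the worst case is the law on {-B, B} with the same mean, which
    [hoeffding_two_point] handles. The interval has length 2 B, so k^2 B^2 / 2 is the usual k^2 (2
    B)^2 / 8. *)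
Lemma hoeffding_mgf X B k : measurable_fun setT X -> (forall x, `|X x| <= B) ->
  0 <= B -> 0 <= k ->
  (\int[P]_x (expR (k * ((\int[P]_y X y)%R - X x)))%:E <=
   (expR (k ^+ 2 * B ^+ 2 / 2))%:E)%E.
Proof.
move=> mX bX B0 k0; set mu := (\int[P]_y X y)%R.
have mubB : `|mu| <= B by exact: normr_Rintegral_le.
have mexp : measurable_fun setT (fun x => (expR (k * (mu - X x)))%:E).
  apply/measurable_EFinP; apply: measurableT_comp => //.
  by apply: measurable_funM => //; exact: measurable_funB.
have [B00|B1] := eqVneq B 0.
  have X0 x : X x = 0 by apply/eqP; rewrite -normr_le0 -B00.
  have mu0 : mu = 0 by apply/eqP; rewrite -normr_le0 -B00.
  rewrite [X in (X <= _)%E](_ : _ = \int[P]_x 1%:E)%E; last first.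
    by apply: eq_integral => x _; rewrite X0 mu0 subrr mulr0 expR0.
  rewrite integral_cst// [X in (_ * X)%E]probability_setT mule1 lee_fin.
  by rewrite B00 expr0n mulr0 mul0r expR0.
have {}B0 : 0 < B by rewrite lt_neqAle eq_sym B1.
have pq x : `|x| <= B ->
    [/\ 0 <= (1 - x / B) / 2, 0 <= (1 + x / B) / 2 & (1 - x / B) / 2 + (1 + x / B) / 2 = 1].
  rewrite ler_norml => /andP[h1 h2].
  have : x / B <= 1 by rewrite ler_pdivrMr// mul1r.
  have : -1 <= x / B by rewrite ler_pdivlMr// mulN1r.
  by split; lra.
(* al + be x is the chord of exp(k (mu - x)) over [-B, B]. Being affine, it has an integral that
   depends on [X] only through the mean. *)
pose al := expR (k * mu) * ((expR (k * B) + expR (- (k * B))) / 2).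
pose be := expR (k * mu) * ((expR (- (k * B)) - expR (k * B)) / (2 * B)).
have iX := integrable_bounded mX bX.
have ial : P.-integrable setT (fun=> al%:E) by exact: finite_measure_integrable_cst.
have ibe : P.-integrable setT (fun x => (be * X x)%:E).
  by under eq_fun do rewrite EFinM; exact: integrableZl.
have le x : expR (k * (mu - X x)) <= al + be * X x.
  have [p0 q0 pq1] := pq _ (bX x).
  have := expR_chord (k * B) (- (k * B)) p0 q0 pq1.
  rewrite (_ : _ + _ = - (k * X x)); last by field.
  rewrite mulrBr expRD => /(ler_wpM2l (expR_ge0 (k * mu))) /le_trans; apply.
  rewrite le_eqVlt; apply/orP; left; apply/eqP; rewrite /al /be; by field.
apply: (@le_trans _ _ (\int[P]_x (al%:E + (be * X x)%:E))%E).
  apply: ge0_le_integral => //.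
  - by apply: emeasurable_funD => //; exact: (measurable_int P ibe).
  - by move=> x _; rewrite -EFinD lee_fin.
rewrite integralD// integral_cst// [X in (_ * X)%E]probability_setT mule1.
under eq_integral do rewrite EFinM.
rewrite integralZl// [X in (_ * X)%E](_ : _ = mu%:E); last first.
  by rewrite /mu /Rintegral fineK//; exact: integrable_fin_num.
rewrite -EFinM -EFinD lee_fin.
have [p0 q0 pq1] := pq _ mubB.
have kB : 0 <= k * B by rewrite mulr_ge0// ltW.
have := hoeffding_two_point p0 q0 pq1 kB.
move/(ler_wpM2l (expR_ge0 (k * mu))); rewrite -expRD.
rewrite (_ : k * mu + _ = k ^+ 2 * B ^+ 2 / 2); last by field.
apply: le_trans; rewrite le_eqVlt; apply/orP; left; apply/eqP.
by rewrite /al /be; field.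
Qed.

Lemma hoeffding_iid_mgf n X B k : (0 < n)%N -> measurable_fun setT X ->
  (forall x, `|X x| <= B) -> 0 <= B -> 0 <= k ->
  (\int[iid_probability P n]_s
     (expR (k * ((\int[P]_y X y)%R - n%:R^-1 * \sum_(i < n) X (tnth s i))))%:E <=
   (expR (k ^+ 2 * B ^+ 2 / (2 * n%:R)))%:E)%E.
Proof.
move=> n0 mX bX B0 k0; set mu := (\int[P]_y X y)%R.
have nR : n%:R != 0 :> R by rewrite pnatr_eq0 -lt0n.
have kn0 : 0 <= k / n%:R by rewrite divr_ge0.
have mf : measurable_fun setT (fun x => (expR (k / n%:R * (mu - X x)))%:E).
  apply/measurable_EFinP; apply: measurableT_comp => //.
  by apply: measurable_funM => //; exact: measurable_funB.
have := ge0_integral_iid_prod_le n mf (fun x => expR_ge0 _)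
  (hoeffding_mgf mX bX B0 kn0).
rewrite -expRM_natl (_ : n%:R * _ = k ^+ 2 * B ^+ 2 / (2 * n%:R)); last by field.
apply: le_trans; rewrite le_eqVlt; apply/orP; left; apply/eqP.
apply: eq_integral => s _; rewrite prodEFin -expR_sum; congr (expR _)%:E.
rewrite -mulr_sumr sumrB sumr_const card_ord -[mu *+ n]mulr_natr.
by field.
Qed.

End moment_generating.

(** * PAC-Bayes bounds *)

Section pac_bayes.
Context {d : measure_display} {T : measurableType d} {R : realType}.
Context {m n : nat}.
Local Notation RR := (measurableTypeR R).
Local Notation gauss s := (iid_probability (normal_prob (0 : R) s) m).
Variable D : probability T R.
Implicit Types (F : 'rV[R]_m -> T -> R) (A b k s : R) (v w : 'rV[R]_m).
Implicit Types (S : n.-tuple T).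

Definition risk F v : R := (\int[D]_p F v p)%R.

Definition gap F S v : R := risk F v - n%:R^-1 * \sum_(i < n) F v (tnth S i).

(** The bound b may depend on v, since the loss grows with the weights; the Lipschitz constant is
    uniform in the data point. *)
Record loss_family A F : Prop := LossFamily {
  loss_measurable : forall v, measurable_fun setT (F v) ;
  loss_lipschitz : forall p, l1_lipschitz A (F ^~ p) ;
  loss_bounded : forall v, exists b, forall p, `|F v p| <= b }.

Lemma loss_integrable A F v : loss_family A F -> D.-integrable setT (EFin \o F v).
Proof.
move=> lF; have [b hb] := loss_bounded lF v.
exact: integrable_bounded (loss_measurable lF v) hb.
Qed.

Lemma risk_lipschitz A F : loss_family A F -> l1_lipschitz A (risk F).
Proof.
move=> lF v w; rewrite /risk -RintegralB//; try exact: loss_integrable lF.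
apply: (@normr_Rintegral_le _ _ _ D (fun p => F v p - F w p)).
  by apply: measurable_funB; exact: loss_measurable lF _.
by move=> p; exact: loss_lipschitz lF p v w.
Qed.

Lemma gap_lipschitz A F S : loss_family A F ->
  l1_lipschitz (A + `|n%:R^-1| * (n%:R * A)) (gap F S).
Proof.
move=> lF; apply: l1_lipschitzB; first exact: risk_lipschitz lF.
apply: (l1_lipschitzZ n%:R^-1
  (phi := fun v => \sum_(i < n) F v (tnth S i))).
by apply: l1_lipschitz_sum => i; exact: loss_lipschitz lF _.
Qed.

Lemma measurable_gap A F v : loss_family A F ->
  measurable_fun [set: n.-tuple T] (fun S => gap F S v).
Proof.
move=> lF; apply: measurable_funB => //; apply: measurable_funM => //.
apply: measurable_sum => i.
exact: (measurableT_comp (loss_measurable lF v) (measurable_tnth i)).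
Qed.

(** The prior average of the exponentiated gap. It does not involve w, so one bound on it serves all
    posteriors N(w, s^2 I) at once: this is where uniformity over the weights comes from. *)
Definition partition_function s k F S : \bar R :=
  (\int[gauss s]_u (expR (k * gap F S (row_of u)))%:E)%E.

Lemma measurable_expR_gap A k F : loss_family A F ->
  measurable_fun [set: n.-tuple T * m.-tuple RR]
    (fun z => (expR (k * gap F z.1 (row_of z.2)))%:E).
Proof.
move=> lF; apply/measurable_EFinP; apply: measurableT_comp => //.
apply: measurable_funM => //.
apply: (measurable_caratheodory (F := fun v S => gap F S v)) => [S|v].
  by eexists; exact: gap_lipschitz lF.
exact: measurable_gap lF.
Qed.

Lemma partition_function_ge0 s k F S : (0 <= partition_function s k F S)%E.
Proof. by apply: integral_ge0 => u _; rewrite lee_fin expR_ge0. Qed.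

Lemma measurable_partition_function A s k F : loss_family A F ->
  measurable_fun setT (partition_function s k F).
Proof.
move=> lF.
apply: (@measurable_fun_fubini_tonelli_F _ _ (n.-tuple T) (m.-tuple RR) R
  (gauss s) _ (measurable_expR_gap k lF)).
by move=> z; rewrite lee_fin expR_ge0.
Qed.

(** Tonelli moves the sample inside, where Hoeffding applies at each fixed weight vector. The range
    [B] may vary with the weights: it grows linearly at the coarsest scale and is constant at the
    others. *)
Lemma integral_partition_function_le A s k F (B : 'rV[R]_m -> R) : (0 < n)%N ->
  loss_family A F -> 0 <= k -> (forall v p, `|F v p| <= B v) ->
  (forall v, 0 <= B v) ->
  measurable_fun setT (fun u : m.-tuple RR => B (row_of u)) ->
  (\int[iid_probability D n]_S partition_function s k F S <=
   \int[gauss s]_u (expR (k ^+ 2 * B (row_of u) ^+ 2 / (2 * n%:R)))%:E)%E.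
Proof.
move=> n0 lF k0 FB B0 mB.
have e0 (z : n.-tuple T * m.-tuple RR) :
  (0 <= (expR (k * gap F z.1 (row_of z.2)))%:E)%E by rewrite lee_fin expR_ge0.
rewrite [X in (X <= _)%E](fubini_tonelli _ (measurable_expR_gap k lF) e0).
apply: ge0_le_integral => //.
- by move=> u _; apply: integral_ge0.
- exact: (@measurable_fun_fubini_tonelli_G _ _ (n.-tuple T) (m.-tuple RR) R
    (iid_probability D n) _ (measurable_expR_gap k lF) e0).
- apply/measurable_EFinP; apply: measurableT_comp => //.
  apply: measurable_funM => //; apply: measurable_funM => //.
  exact: measurable_funX.
- move=> u _; rewrite /=.
  exact (@hoeffding_iid_mgf _ _ _ D n (F (row_of u)) (B (row_of u)) k n0
    (loss_measurable lF _) (FB _) (B0 _) k0).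
Qed.

Lemma change_of_measure A s k F S w : 0 < s -> loss_family A F ->
  ((expR (k * gauss_mean s (fun u => gap F S (w + u)) - sqn w / (s ^+ 2 *+ 2)))%:E
   <= partition_function s k F S)%E.
Proof.
move=> s0 lF; have lg := gap_lipschitz S lF.
rewrite -(gauss_meanZ k s0 (l1_lipschitz_shift w lg)).
exact: (gauss_donsker_varadhan w s0 (l1_lipschitzZ k lg)).
Qed.

Lemma measurable_loss_row A F v : loss_family A F ->
  measurable_fun [set: T * m.-tuple RR]
    (fun z => (F (v + row_of z.2) z.1)%:E).
Proof.
move=> lF; apply/measurable_EFinP.
apply: (measurable_caratheodory (F := fun u p => F (v + u) p)) => [p|u].
  by exists A; exact: (l1_lipschitz_shift v (loss_lipschitz lF p)).
exact: (loss_measurable lF (v + u)).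
Qed.

Lemma l1_lipschitz_l1 : l1_lipschitz 1 (@l1 R m).
Proof.
move=> v w; rewrite mul1r /l1 -sumrB (le_trans (ler_norm_sum _ _ _))//.
by apply: ler_sum => i _; rewrite !mxE ler_dist_dist.
Qed.

(** This licenses Fubini between the data and the perturbation; the dominating function is b + |A|
    l1(u). *)
Lemma integrable_loss_row A F s v : 0 < s -> loss_family A F ->
  (D \x gauss s)%E.-integrable setT
    (fun z : T * m.-tuple RR => (F (v + row_of z.2) z.1)%:E).
Proof.
move=> s0 lF; have [b hb] := loss_bounded lF v.
have mF := measurable_loss_row v lF.
apply/integrable12ltyP; first exact: mF.
have lb := l1_lipschitzD (l1_lipschitz_cst b) (l1_lipschitzZ `|A| l1_lipschitz_l1).
set B := (fun u => _) in lb.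
apply: (@le_lt_trans _ _ (\int[D]_p (gauss_mean s B)%:E)%E); last first.
  rewrite integral_cst// [X in (_ * X)%E]probability_setT mule1.
  by rewrite ltry.
have mabs : measurable_fun [set: T * m.-tuple RR]
    (fun z => `|(F (v + row_of z.2) z.1)%:E|%E).
  exact: measurableT_comp.
apply: ge0_le_integral => //.
- by move=> p _; exact: integral_ge0.
- exact: (@measurable_fun_fubini_tonelli_F _ _ T (m.-tuple RR) R
    (gauss s) _ mabs).
- move=> p _; rewrite (gauss_meanE s0 lb); apply: ge0_le_integral => //.
  + exact: (measurableT_comp mabs (pair1_measurable p)).
  + by apply/measurable_EFinP; exact: measurable_l1_lipschitz lb.
  + move=> u _ /=; rewrite lee_fin /B.
    rewrite -[F _ _](subrK (F v p)) addrC (le_trans (ler_normD _ _))// lerD//.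
    rewrite (le_trans (l1_lipschitz_weaken (loss_lipschitz lF p) _ _))//.
    by rewrite addrAC subrr add0r.
Qed.

(** With s = sqrt 3 sigma / 2^j this is the function G_j of the overview. *)
Definition smoothing_gap s F v p : R :=
  F v p - gauss_mean s (fun u => F (v + u) p).

Lemma measurable_gauss_mean_loss A F s v : 0 < s -> loss_family A F ->
  measurable_fun setT (fun p => gauss_mean s (fun u => F (v + u) p)).
Proof.
move=> s0 lF; apply/measurable_EFinP.
have mfub := measurable_fubini_F (integrable_loss_row v s0 lF).
rewrite (_ : _ \o _ = (fun p => \int[gauss s]_u (F (v + row_of u) p)%:E)%E)//.
apply/funext => p /=.
exact: (gauss_meanE s0 (l1_lipschitz_shift v (loss_lipschitz lF p))).
Qed.

Lemma risk_gauss_mean A F s v : 0 < s -> loss_family A F ->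
  risk (fun v p => gauss_mean s (fun u => F (v + u) p)) v =
  gauss_mean s (fun u => risk F (v + u)).
Proof.
move=> s0 lF; apply: EFin_inj.
have lr := l1_lipschitz_shift v (risk_lipschitz lF).
rewrite [RHS](gauss_meanE s0 lr).
transitivity (\int[gauss s]_u \int[D]_p (F (v + row_of u) p)%:E)%E; last first.
  apply: eq_integral => u _; rewrite /risk /Rintegral fineK//.
  by apply: integrable_fin_num => //; exact: (loss_integrable _ lF).
rewrite -(Fubini (integrable_loss_row v s0 lF)).
have E p : (\int[gauss s]_u (F (v + row_of u) p)%:E =
    (gauss_mean s (fun u => F (v + u) p))%:E)%E.
  by rewrite (gauss_meanE s0 (l1_lipschitz_shift v (loss_lipschitz lF p))).
rewrite /risk /Rintegral fineK; first by apply: eq_integral => p _; rewrite E.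
apply: integrable_fin_num => //.
have := integrable_fubini_F (integrable_loss_row v s0 lF).
by apply: eq_integrable => // p _; rewrite /fubini_F E.
Qed.

(** A smoothing error is again an admissible loss, so the PAC-Bayes bounds can be applied to it in
    turn. *)
Lemma smoothing_gap_family A F s b : 0 < s -> loss_family A F ->
  (forall v p, `|smoothing_gap s F v p| <= b) ->
  loss_family (A + A) (smoothing_gap s F).
Proof.
move=> s0 lF hb; split=> [v|p|v].
- apply: measurable_funB; first exact: loss_measurable lF v.
  exact: measurable_gauss_mean_loss lF.
- apply: l1_lipschitzB; first exact: loss_lipschitz lF p.
  exact: l1_lipschitz_gauss_mean (loss_lipschitz lF p).
- by exists b => p; exact: hb.
Qed.

(** Taking the gap is linear in the loss and commutes with Gaussian averaging, by Fubini for the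
    risk and by finite additivity for the empirical part. *)
Lemma gap_smoothing A F s S v : 0 < s -> loss_family A F ->
  (exists b, forall v p, `|smoothing_gap s F v p| <= b) ->
  gap (smoothing_gap s F) S v =
  gap F S v - gauss_mean s (fun u => gap F S (v + u)).
Proof.
move=> s0 lF [b hb]; have lG := smoothing_gap_family s0 lF hb.
have lFv := fun p => l1_lipschitz_shift v (loss_lipschitz lF p).
have lr := l1_lipschitz_shift v (risk_lipschitz lF).
have lS := l1_lipschitz_sum (fun i => lFv (tnth S i)).
rewrite (gauss_meanB s0 lr (l1_lipschitzZ _ lS)) (gauss_meanZ _ s0 lS).
rewrite (gauss_mean_sum s0 (fun i => lFv (tnth S i))).
rewrite -(risk_gauss_mean v s0 lF).
have rE : risk (smoothing_gap s F) v = risk F v -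
    risk (fun v p => gauss_mean s (fun u => F (v + u) p)) v.
  rewrite /risk -RintegralB//; first exact: loss_integrable lF.
  (* The averaged loss is the loss minus its smoothing gap, hence bounded by b0 + b and
     integrable. *)
  have [b0 hb0] := loss_bounded lF v.
  apply: (@integrable_bounded _ _ _ _ _ (b0 + b)).
    exact: measurable_gauss_mean_loss lF.
  move=> p; rewrite -[gauss_mean _ _](subKr (F v p)).
  by rewrite (le_trans (ler_normB _ _))// lerD//; exact: hb.
rewrite /gap rE /smoothing_gap sumrB; ring.
Qed.

End pac_bayes.

(** * The multi-scale argument *)

Section weighted_markov.
Context {d : measure_display} {T : measurableType d} {R : realType}.
Variable P : probability T R.

(** Level j holds up to the price -ln(w_j delta) in the exponent, and the single exceptional event
    has probability at most delta for all levels together. *)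
Lemma weighted_markov K (Z : 'I_K -> T -> \bar R) (a w : 'I_K -> R) (delta : R) :
  (forall j, measurable_fun setT (Z j)) -> (forall j x, (0 <= Z j x)%E) ->
  (forall j, (\int[P]_x Z j x <= (expR (a j))%:E)%E) ->
  (forall j, 0 < w j) -> \sum_j w j <= 1 -> 0 < delta ->
  exists E : set T, [/\ measurable E, ((1 - delta)%:E <= P E)%E &
    forall x, E x -> forall j, (Z j x <= (expR (a j) / (w j * delta))%:E)%E].
Proof.
move=> mZ Z0 ZA w0 w1 delta0.
(* This normalisation gives the j-th summand mean at most w_j, so the sum has mean at most 1. Each
   summand is below the sum, which stays under 1 / delta on the good event. *)
pose c j := w j * expR (- a j).
have c0 j : 0 < c j by rewrite mulr_gt0 ?expR_gt0.
have cZ0 j x : (0 <= (c j)%:E * Z j x)%E by rewrite mule_ge0// lee_fin ltW.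
pose W x := (\sum_j (c j)%:E * Z j x)%E.
have W0 x : (0 <= W x)%E by apply: sume_ge0.
have mW : measurable_fun setT W.
  by apply: emeasurable_sum => j; exact: measurable_funeM.
have IW : (\int[P]_x W x <= 1)%E.
  rewrite ge0_integral_sum//; last by move=> j; exact: measurable_funeM.
  apply: (@le_trans _ _ (\sum_j (w j)%:E)%E); last by rewrite sumEFin lee_fin.
  apply: lee_sum => j _; rewrite ge0_integralZl//; last by rewrite lee_fin ltW.
  have -> : (w j)%:E = ((c j)%:E * (expR (a j))%:E)%E.
    by rewrite -EFinM /c -mulrA -expRD addNr expR0 mulr1.
  by apply: lee_wpmul2l => //; rewrite lee_fin ltW.
pose E := [set x | (W x <= (delta^-1)%:E)%E].
have mE : measurable E.
  by rewrite -[E]setTI; exact: emeasurable_fun_infty_c.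
exists E; split=> //.
  have mEC : measurable (~` E) by exact: measurableC.
  have PEC : ((delta^-1)%:E * P (~` E) <= 1)%E.
    apply: le_trans IW; rewrite -(integral_cst P mEC).
    apply: (@le_trans _ _ (\int[P]_(x in ~` E) W x)%E).
      apply: ge0_le_integral => //.
      - by move=> x _; rewrite lee_fin invr_ge0 ltW.
      - exact: measurable_funTS.
      - by move=> x; rewrite /E /= => /negP; rewrite -ltNge => /ltW.
    exact: ge0_subset_integral.
  have PE := probability_setC P mEC; rewrite setCK in PE; rewrite PE.
  have : (P (~` E) <= 1)%E by exact: probability_le1.
  have : (0 <= P (~` E))%E by [].
  move: PEC; case: (P (~` E)) => [p|//|//] + p0 p1.
  rewrite -EFinM !lee_fin mulrC ler_pdivrMr// mul1r => pd.
  lra.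
move=> x Ex j.
have : ((c j)%:E * Z j x <= (delta^-1)%:E)%E.
  apply: le_trans Ex; rewrite /W (bigD1 j)//= leeDl//.
  by apply: sume_ge0.
move: (Z0 j x); case: (Z j x) => [z|//|//] z0.
  rewrite -EFinM !lee_fin => h.
  rewrite ler_pdivlMr ?mulr_gt0//.
  have ea : c j * expR (a j) = w j by rewrite /c -mulrA -expRD addNr expR0 mulr1.
  rewrite -ea.
  have := ler_wpM2l (ltW (expR_gt0 (a j))) (ler_wpM2r (ltW delta0) h).
  rewrite mulVf ?gt_eqF// mulr1; apply: le_trans.
  by rewrite le_eqVlt; apply/orP; left; apply/eqP; ring.
by rewrite gt0_muley ?lte_fin.
Qed.

End weighted_markov.

Section multiscale.
Context {d : measure_display} {T : measurableType d} {R : realType}.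
Context {m n : nat}.
Local Notation RR := (measurableTypeR R).
Local Notation gauss s := (iid_probability (normal_prob (0 : R) s) m).
Variable D : probability T R.

(** With t = 1 / (2 s^2 (m+1)) each coordinate contributes sqrt(1 + 1/m) <= exp(1 / (2 m)), and the
    m factors multiply to at most exp(1/2). *)
Lemma integral_gauss_expR_sqn_le (s : R) : (0 < m)%N -> 0 < s ->
  (\int[gauss s]_u (expR (sqn (row_of u) / (2 * s ^+ 2 * m.+1%:R)))%:E <=
   (expR (2^-1))%:E)%E.
Proof.
move=> m0 s0.
have mR : 0 < m%:R :> R by rewrite ltr0n.
pose t := (2 * s ^+ 2 * m.+1%:R)^-1.
have tE : 1 - 2 * t * s ^+ 2 = m%:R / m.+1%:R.
  have -> : m%:R = m.+1%:R - 1 :> R by rewrite -natr1 addrK.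
  have M0 : m.+1%:R != 0 :> R by rewrite pnatr_eq0.
  rewrite /t; move: m.+1%:R M0 => M M0.
  by field; rewrite M0 gt_eqF.
have q0 : 0 < 1 - 2 * t * s ^+ 2 by rewrite tE divr_gt0.
have le1 : (\int[normal_prob 0 s]_x (expR (t * x ^+ 2))%:E <=
    (expR ((2 * m%:R)^-1))%:E)%E.
  rewrite integral_normal_expR_sqr// lee_fin tE.
  rewrite -(@ler_pXn2r _ 2) ?nnegrE ?invr_ge0 ?sqrtr_ge0 ?expR_ge0//.
  rewrite exprVn sqr_sqrtr ?divr_ge0// invf_div -expRM_natl.
  rewrite (_ : 2 * (2 * m%:R)^-1 = m%:R^-1); last by field; rewrite gt_eqF.
  rewrite -natr1 mulrDl divff ?gt_eqF// mul1r.
  exact: expR_ge1Dx.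
have mf : measurable_fun [set: RR] (fun x : RR => (expR (t * (x : R) ^+ 2))%:E).
  apply/measurable_EFinP; apply: measurableT_comp => //.
  by apply: measurable_funM => //; exact: measurable_funX.
have := ge0_integral_iid_prod_le m mf (fun x => expR_ge0 _) le1.
rewrite -expRM_natl (_ : m%:R * _ = 2^-1); last by field; rewrite gt_eqF.
apply: le_trans; rewrite le_eqVlt; apply/orP; left; apply/eqP.
apply: eq_integral => u _; rewrite prodEFin -expR_sum; congr (expR _)%:E.
rewrite mulrC /sqn mulr_sumr; apply: eq_bigr => i _.
by rewrite mxE.
Qed.

End multiscale.

Section multiscale.
Context {d : measure_display} {T : measurableType d} {R : realType}.
Context {m n : nat}.
Local Notation RR := (measurableTypeR R).
Local Notation gauss s := (iid_probability (normal_prob (0 : R) s) m).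
Variable D : probability T R.
Implicit Types (F : 'rV[R]_m -> T -> R) (A b k s a : R) (v w : 'rV[R]_m).
Implicit Types (S : n.-tuple T).

Lemma sqn_ge0 v : 0 <= sqn v.
Proof. by apply: sumr_ge0 => i _; exact: sqr_ge0. Qed.

(** Adding independent perturbations of scales s and sqrt 3 s yields one of scale 2 s. One
    telescoping step is therefore the Gaussian mean of the gap of a single bounded loss. *)
Lemma gauss_mean_gap_smoothing A F s S w : 0 < s -> loss_family A F ->
  (exists b, forall v p, `|smoothing_gap (Num.sqrt 3 * s) F v p| <= b) ->
  gauss_mean s (fun u => gap D (smoothing_gap (Num.sqrt 3 * s) F) S (w + u)) =
  gauss_mean s (fun u => gap D F S (w + u)) -
  gauss_mean (2 * s) (fun u => gap D F S (w + u)).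
Proof.
move=> s0 lF hb.
have t0 : 0 < Num.sqrt 3 * s by rewrite mulr_gt0// sqrtr_gt0.
have lg := gap_lipschitz D S lF.
have lgw := l1_lipschitz_shift w lg.
have cE : (2 * s) ^+ 2 = s ^+ 2 + (Num.sqrt 3 * s) ^+ 2.
  by rewrite !exprMn sqr_sqrtr//; ring.
have s20 : 0 < 2 * s by rewrite mulr_gt0.
rewrite -(gauss_mean_convolution s0 t0 s20 cE lgw).
rewrite -(gauss_meanB s0 lgw (l1_lipschitz_gauss_mean t0 lgw)).
congr gauss_mean; apply/funext => u; rewrite (gap_smoothing D S _ t0 lF hb).
by congr (_ - gauss_mean _ _); apply/funext => x; rewrite addrA.
Qed.

(** This ends the telescope at the finest scale without any concentration: the risk and the
    empirical mean of the smoothing gap are each at most b in absolute value. *)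
Lemma gap_le_gauss_mean A F s b S w : (0 < n)%N -> 0 < s -> loss_family A F ->
  (forall v p, `|smoothing_gap s F v p| <= b) ->
  gap D F S w <= gauss_mean s (fun u => gap D F S (w + u)) + 2 * b.
Proof.
move=> n0 s0 lF hb.
have lG := smoothing_gap_family D s0 lF hb.
rewrite -lerBlDl -(gap_smoothing D S w s0 lF); last by exists b.
rewrite (le_trans (ler_norm _))// (le_trans (ler_normB _ _))//.
rewrite mulr_natl mulr2n lerD//.
  by apply: normr_Rintegral_le => [|p]; [exact: loss_measurable lG w|exact: hb].
rewrite normrM ger0_norm ?invr_ge0// mulrC ler_pdivrMr ?ltr0n//.
rewrite (le_trans (ler_norm_sum _ _ _))//.
rewrite (le_trans (ler_sum _ (fun i _ => hb w (tnth S i))))//.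
by rewrite sumr_const card_ord mulr_natr.
Qed.

Lemma gauss_mean_gap_le A F s k a wd S w : 0 < s -> loss_family A F -> 0 < wd ->
  (partition_function D s k F S <= (expR a / wd)%:E)%E ->
  k * gauss_mean s (fun u => gap D F S (w + u)) <=
  sqn w / (s ^+ 2 *+ 2) + a - ln wd.
Proof.
move=> s0 lF wd0 /(le_trans (change_of_measure D k S w s0 lF)).
have -> : expR a / wd = expR (a - ln wd) by rewrite expRD expRN lnK.
rewrite lee_fin ler_expR; lra.
Qed.

(** The price of level j is relaxed to grow like 4^j, the rate of the relative entropy, so that one
    square can absorb both. *)
Lemma ln_level_le (delta : R) (j : nat) : 0 < delta -> delta <= 1 ->
  - ln (2 ^- j.+1 * delta) <= 4 ^+ j * ln (8 / delta).
Proof.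
move=> d0 d1.
have d8 : 8 <= 8 / delta by rewrite ler_pdivlMr//; lra.
have l80 : 0 <= ln (8 / delta) by rewrite ln_ge0//; lra.
apply: (@le_trans _ _ (j.+1%:R * ln (8 / delta))).
  rewrite mulr_natl -lnXn; last by lra.
  rewrite -lnV ?posrE ?mulr_gt0// ler_ln ?posrE ?invr_gt0 ?mulr_gt0 ?exprn_gt0//; last by lra.
  rewrite invfM invrK expr_div_n; apply: ler_pM.
  - by rewrite exprn_ge0.
  - by rewrite invr_ge0 ltW.
  - by apply: lerXn2r; rewrite ?nnegrE; lra.
  - rewrite lef_pV2 ?posrE ?exprn_gt0// -[leRHS]expr1.
    by rewrite ler_wiXn2l// ltW.
rewrite ler_wpM2r// -natrX ler_nat.
elim: j => [//|j IH]; rewrite expnS; lia.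
Qed.

Lemma sum_half_pow_le1 K : \sum_(j < K) 2 ^- j.+1 <= 1 :> R.
Proof.
suff -> : \sum_(j < K) 2 ^- j.+1 = 1 - 2 ^- K :> R.
  by rewrite gerBl invr_ge0 exprn_ge0.
elim: K => [|K IH]; first by rewrite big_ord0 expr0 invr1 subrr.
rewrite big_ord_recr/= IH exprS; field.
by rewrite expf_neq0.
Qed.

(** In the application x is the relative entropy, z the price of the level, and the middle term
    Hoeffding's exponent. *)
Lemma le_sqrD_half (x z p q : R) : x <= p ^+ 2 / 2 -> z <= q ^+ 2 / 2 ->
  0 <= p -> 0 <= q -> x + (p + q) ^+ 2 / 2 + z <= (p + q) ^+ 2.
Proof.
move=> h1 h2 p0 q0.
rewrite (_ : (p + q) ^+ 2 = p ^+ 2 + q ^+ 2 + 2 * (p * q)); last by ring.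
have := mulr_ge0 p0 q0; lra.
Qed.

Lemma geometric_telescope (f : nat -> R) (U : R) (K j : nat) :
  (forall i, (i < K)%N -> f i.+1 <= f i + U * 2 ^- i.+1) -> (j <= K)%N ->
  f j <= f 0%N + U * (1 - 2 ^- j).
Proof.
move=> h; elim: j => [_|j IH jK]; first by rewrite expr0 invr1 subrr mulr0 addr0.
apply: (le_trans (h j jK)); have := IH (ltnW jK).
rewrite exprS invfM; move: (2 ^- j) (f j) (f 0%N) => q x z; lra.
Qed.

(** The three summands are the PAC-Bayes bound at scale sigma, the sum of the K telescoping steps,
    and the smoothing error left at scale sigma / 2^K. *)
Theorem multiscale_bound A F (Lam b r sigma delta : R) (K : nat) :
  (0 < m)%N -> (0 < n)%N -> loss_family A F ->
  0 < Lam -> (forall v p, `|F v p| <= Lam * Num.sqrt (sqn v)) ->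
  0 <= b -> ((0 < K)%N -> 0 < b) ->
  (forall s v p, 0 < s -> `|smoothing_gap s F v p| <= b * s ^+ 2) ->
  0 <= r -> 0 < sigma -> 0 < delta -> delta <= 1 ->
  exists E : set (n.-tuple T), [/\ measurable E,
    ((1 - delta)%:E <= iid_probability D n E)%E &
    forall S, E S -> forall w, sqn w <= r ^+ 2 ->
    gap D F S w <=
      Lam * sigma * Num.sqrt m.+1%:R / Num.sqrt n%:R *
        (sqn w / (sigma ^+ 2 *+ 2) + 2^-1 + ln (2 / delta)) +
      3 * b * sigma * (r + Num.sqrt (2 * ln (8 / delta)) * sigma) / Num.sqrt n%:R +
      2 * (b * (sigma / 2 ^+ K) ^+ 2)].
Proof.
move=> m0 n0 lF Lam0 hLam b0 hK hb r0 sigma0 delta0 delta1.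
set c := Num.sqrt (2 * ln (8 / delta)).
have l80 : 0 < ln (8 / delta).
  by rewrite ln_gt0// ltr_pdivlMr//; lra.
have c0 : 0 < c by rewrite sqrtr_gt0 mulr_gt0.
have cE : c ^+ 2 = 2 * ln (8 / delta) by rewrite sqr_sqrtr// mulr_ge0// ltW.
have sn0 : 0 < Num.sqrt n%:R :> R by rewrite sqrtr_gt0 ltr0n.
have snE : Num.sqrt n%:R ^+ 2 = n%:R :> R by rewrite sqr_sqrtr.
have sm0 : 0 < Num.sqrt m.+1%:R :> R by rewrite sqrtr_gt0.
have smE : Num.sqrt m.+1%:R ^+ 2 = m.+1%:R :> R by rewrite sqr_sqrtr.
have p2 j : 0 < (2 : R) ^+ j by rewrite exprn_gt0.
pose sg j := sigma / 2 ^+ j.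
have sg0 j : 0 < sg j by rewrite divr_gt0.
(* The two parts of y_j have half-squares 4^j r^2 / (2 sigma^2), which bounds the relative entropy
   at scale sigma / 2^j, and 4^j ln(8 / delta), which bounds the price of the level. *)
pose y j := 2 ^+ j * (r / sigma + c).
have y0 j : 0 < y j by rewrite mulr_gt0// ltr_wpDl// divr_ge0// ltW.
(* The factor 3 is the square of the smoothing scale sqrt 3 relative to [sg j]. *)
pose B j := 3 * b * sg j ^+ 2.
pose H j := if j is 0%N then F else smoothing_gap (Num.sqrt 3 * sg j) F.
(* At a scale [j > 0] this inverse temperature balances the entropy term
   [(y j) ^+ 2] against Hoeffding's term [(k j * B j) ^+ 2 / n]. *)
pose k j := if j is 0%N then Num.sqrt n%:R / (Lam * sigma * Num.sqrt m.+1%:R)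
            else Num.sqrt n%:R * y j / B j.
(* Logarithms of the exponential moments: 1/2 from the Gaussian integral at level 0, and Hoeffding's
   k^2 B^2 / (2 n) = y^2 / 2 above it. *)
pose a j := if j is 0%N then 2^-1 else y j ^+ 2 / 2.
have s30 j : 0 < Num.sqrt 3 * sg j by rewrite mulr_gt0// sqrtr_gt0.
have hB j v p : `|smoothing_gap (Num.sqrt 3 * sg j) F v p| <= B j.
  rewrite (_ : B j = b * (Num.sqrt 3 * sg j) ^+ 2); first exact: hb.
  by rewrite /B [(Num.sqrt 3 * _) ^+ 2]exprMn sqr_sqrtr//; ring.
have lH j : exists A', loss_family A' (H j).
  case: j => [|j]; first by exists A.
  by exists (A + A); exact: smoothing_gap_family (s30 _) lF (hB _).
have B0 j : (0 < j <= K)%N -> 0 < B j.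
  move=> /andP[j0 jK]; rewrite mulr_gt0 ?exprn_gt0// mulr_gt0// hK//.
  exact: leq_trans jK.
have k0 j : (j <= K)%N -> 0 < k j.
  case: j => [_|j jK]; first by rewrite divr_gt0 ?mulr_gt0.
  by apply: divr_gt0; [apply: mulr_gt0|exact: B0].
have hZ (j : 'I_K.+1) : (\int[iid_probability D n]_S
    partition_function D (sg j) (k j) (H j) S <= (expR (a j))%:E)%E.
  case: j => -[|j] /= jK; have [A' lA] := lH (nat_of_ord (Ordinal jK)).
    have mB : measurable_fun [set: m.-tuple RR]
        (fun u => Lam * Num.sqrt (sqn (row_of u))).
      apply: measurable_funM => //; apply: measurableT_comp.
        by apply: continuous_measurable_fun; exact: sqrt_continuous.
      apply: measurable_sum => i; apply: measurable_funX.
      by under eq_fun do rewrite mxE; exact: measurable_tnthR.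
    have Bp v : 0 <= Lam * Num.sqrt (sqn v) by rewrite mulr_ge0 ?sqrtr_ge0// ltW.
    apply: le_trans (integral_partition_function_le D _ n0 lF (ltW (k0 0%N isT)) hLam Bp mB) _.
    (* The value of [k] at level 0 turns Hoeffding's exponent into exactly |u|^2 / (2 sigma^2
       (m+1)). *)
    rewrite /sg expr0 divr1; apply: le_trans (integral_gauss_expR_sqn_le m0 sigma0).
    rewrite le_eqVlt; apply/orP; left; apply/eqP.
    apply: eq_integral => u _; congr (expR _)%:E.
    rewrite [(Lam * _) ^+ 2]exprMn sqr_sqrtr ?sqn_ge0// /k expr_div_n snE.
    rewrite [(Lam * sigma * _) ^+ 2]exprMn smE.
    have M0 : m.+1%:R != 0 :> R by rewrite pnatr_eq0.
    have N0 : n%:R != 0 :> R by rewrite pnatr_eq0 -lt0n.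
    move: m.+1%:R n%:R M0 N0 => M N M0 N0.
    by field; rewrite M0 N0 !gt_eqF.
  have Bj0 : 0 < B j.+1 by rewrite B0.
  have := integral_partition_function_le D (sg j.+1) n0 lA (ltW (k0 j.+1 jK))
    (hB j.+1) (fun=> ltW Bj0) (measurable_cst _).
  move/le_trans; apply.
  rewrite integral_cst// [X in (_ * X)%E]probability_setT mule1 lee_fin ler_expR.
  rewrite le_eqVlt; apply/orP; left; apply/eqP.
  rewrite expr_div_n exprMn snE.
  have N0 : n%:R != 0 :> R by rewrite pnatr_eq0 -lt0n.
  by field; rewrite N0 gt_eqF.
have mZ (j : 'I_K.+1) : measurable_fun [set: n.-tuple T]
    (partition_function D (sg j) (k j) (H j)).
  by have [A' lA] := lH j; exact: measurable_partition_function lA.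
have wj0 (j : 'I_K.+1) : 0 < 2 ^- j.+1 :> R by rewrite invr_gt0.
have [E [mE PE hE]] := weighted_markov mZ
  (fun j S => partition_function_ge0 D (sg j) (k j) (H j) S) hZ wj0
  (sum_half_pow_le1 K.+1) delta0.
exists E; split=> // S ES w wr.
pose f j := gauss_mean (sg j) (fun u => gap D F S (w + u)).
pose U := 3 * b * sigma * (r + c * sigma) / Num.sqrt n%:R.
have level j : (j <= K)%N ->
    k j * gauss_mean (sg j) (fun u => gap D (H j) S (w + u)) <=
    sqn w / (sg j ^+ 2 *+ 2) + a j - ln (2 ^- j.+1 * delta).
  rewrite -ltnS => jK; have [A' lA] := lH j.
  apply: (gauss_mean_gap_le w (sg0 j) lA); first by rewrite mulr_gt0// invr_gt0.
  exact: (hE S ES (Ordinal jK)).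
(* Level 0 has weight 1/2, whence ln(2 / delta). *)
have f0 : f 0%N <= Lam * sigma * Num.sqrt m.+1%:R / Num.sqrt n%:R *
    (sqn w / (sigma ^+ 2 *+ 2) + 2^-1 + ln (2 / delta)).
  have := level 0%N isT; rewrite /f /sg expr0 divr1 expr1 /a.
  rewrite -lnV ?posrE ?mulr_gt0 ?invr_gt0// invfM invrK.
  rewrite -ler_pdivlMl ?k0// => h; apply: le_trans h _.
  by rewrite /k invf_div.
have fS j : (j < K)%N -> f j.+1 <= f j + U * 2 ^- j.+1.
  move=> jK; have := level j.+1 jK.
  have Bj0 : 0 < B j.+1 by rewrite B0.
  rewrite (gauss_mean_gap_smoothing S w (sg0 j.+1) lF); last by exists (B j.+1); exact: hB.
  rewrite (_ : 2 * sg j.+1 = sg j); last first.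
    by rewrite /sg exprS; field; rewrite gt_eqF.
  rewrite -/(f j) -/(f j.+1) => h.
  have : k j.+1 * (f j.+1 - f j) <= y j.+1 ^+ 2.
    apply: (le_trans h); rewrite /a.
    have h1 : sqn w / (sg j.+1 ^+ 2 *+ 2) <= (2 ^+ j.+1 * (r / sigma)) ^+ 2 / 2.
      rewrite ler_pdivrMr ?pmulrn_lgt0 ?exprn_gt0//.
      apply: le_trans wr _; rewrite le_eqVlt; apply/orP; left; apply/eqP.
      rewrite /sg; have := p2 j.+1; move: (2 ^+ j.+1) => z z0.
      by field; rewrite !gt_eqF.
    have h2 : - ln (2 ^- j.+2 * delta) <= (2 ^+ j.+1 * c) ^+ 2 / 2.
      apply: (le_trans (ln_level_le j.+1 delta0 delta1)).
      rewrite exprMn cE -exprM mulnC exprM (_ : 2 ^+ 2 = 4 :> R); last by ring.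
      by rewrite le_eqVlt; apply/orP; left; apply/eqP; field.
    have h3 : 0 <= 2 ^+ j.+1 * (r / sigma).
      by apply: mulr_ge0; [exact: ltW|apply: divr_ge0 => //; exact: ltW].
    have h4 : 0 <= 2 ^+ j.+1 * c by apply: mulr_ge0; exact: ltW.
    rewrite /y mulrDr; exact: le_sqrD_half.
  (* Dividing by k leaves y B / sqrt n. The factor 2^(j+1) of y against 4^-(j+1) of B makes this
     equal to U 2^-(j+1). *)
  rewrite -ler_pdivlMl ?k0// lerBlDl => h'; apply: le_trans h' _; rewrite lerD2l.
  rewrite le_eqVlt; apply/orP; left; apply/eqP; rewrite /k /U /B /y /sg.
  have b1 : 0 < b by apply: hK; exact: leq_ltn_trans jK.
  have yn0 : r + c * sigma != 0.
    by rewrite gt_eqF// ltr_wpDl// mulr_gt0.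
  have := p2 j.+1; move: (2 ^+ j.+1) => z z0.
  by field; rewrite yn0 !gt_eqF.
have fK := geometric_telescope fS (leqnn K).
have U0 : 0 <= U.
  apply: divr_ge0; last exact: ltW.
  apply: mulr_ge0; first by apply: mulr_ge0; [apply: mulr_ge0|exact: ltW].
  by apply: addr_ge0 => //; apply: mulr_ge0; exact: ltW.
apply: (le_trans (gap_le_gauss_mean S w n0 (sg0 K) lF (fun v p => hb (sg K) v p (sg0 K)))).
rewrite lerD2r (le_trans fK)// lerD//.
by rewrite ler_piMr// gerBl invr_ge0 ltW.
Qed.

End multiscale.

(** * Choice of the number of scales, and constants *)

Section gap_bound.
Context {d : measure_display} {T : measurableType d} {R : realType}.
Context {m n : nat}.
Variable D : probability T R.

(** This gives sqrt(2 ln(8 / delta)) >= 1, so the term carrying that factor can absorb the remainder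
    at the finest scale. *)
Lemma ln_8_div_ge (delta : R) : 0 < delta -> delta <= 1 -> 2^-1 <= ln (8 / delta).
Proof.
move=> d0 d1; apply: (@le_trans _ _ (ln 2)).
  have := @le_ln1Dx R (- 2^-1); rewrite (_ : 1 + - 2^-1 = 2^-1 :> R); last by lra.
  by rewrite lnV ?posrE// lerN2; apply; lra.
have d8 : 8 <= 8 / delta by rewrite ler_pdivlMr//; lra.
rewrite ler_ln ?posrE; lra.
Qed.

(** The reason why n scales suffice: the remainder, of order 4^-n, is then below 1 / sqrt n. *)
Lemma sqrt_le_4X : Num.sqrt n%:R <= 4 ^+ n :> R.
Proof.
apply: (@le_trans _ _ n%:R).
  rewrite -[leRHS](ger0_norm (ler0n R n)) -sqrtr_sqr ler_wsqrtr// -natrX ler_nat.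
  by case: (n) => // j; rewrite expnS expn1 leq_pmulr.
rewrite -natrX ler_nat.
elim: (n) => [//|j IH]; rewrite expnS; lia.
Qed.

(** The bound is written in terms of 2 b because b will be beta C M^2 / 2. The scales cost 3/2 where
    the first term allows 2 sqrt 2, and 3/2 plus 1 for the remainder where the second allows 4. *)
Theorem gap_bound A (F : 'rV[R]_m -> T -> R) (Lam b r sigma delta : R) :
  (0 < m)%N -> (0 < n)%N -> loss_family A F ->
  0 <= Lam -> (forall v p, `|F v p| <= Lam * Num.sqrt (sqn v)) ->
  0 <= b ->
  (forall s v p, 0 < s -> `|smoothing_gap s F v p| <= b * s ^+ 2) ->
  0 <= r -> 0 < sigma -> 0 < delta -> delta <= 1 ->
  exists E : set (n.-tuple T), [/\ measurable E,
    ((1 - delta)%:E <= iid_probability D n E)%E &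
    forall S, E S -> forall w, sqn w <= r ^+ 2 ->
    gap D F S w <=
      2 * Num.sqrt 2 * (2 * b * r * sigma / Num.sqrt n%:R) +
      4 * (2 * b) * sigma ^+ 2 * Num.sqrt (2 * ln (8 / delta) / n%:R) +
      Lam * Num.sqrt m.+1%:R / (2 * sigma * Num.sqrt n%:R) * sqn w +
      Lam * sigma * Num.sqrt m.+1%:R / Num.sqrt n%:R * (ln (2 / delta) + 2^-1)].
Proof.
move=> m0 n0 lF Lam0 hLam b0 hb r0 sigma0 delta0 delta1.
have sn0 : 0 < Num.sqrt n%:R :> R by rewrite sqrtr_gt0 ltr0n.
have l80 := ln_8_div_ge delta0 delta1.
have l20 : 0 <= ln (2 / delta).
  by rewrite ln_ge0// ler_pdivlMr//; lra.
have sm0 : 0 < Num.sqrt m.+1%:R :> R by rewrite sqrtr_gt0.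
have sqE : Num.sqrt (2 * ln (8 / delta) / n%:R) = Num.sqrt (2 * ln (8 / delta)) / Num.sqrt n%:R.
  by rewrite sqrtrM ?sqrtrV// mulr_ge0//; lra.
set c := Num.sqrt (2 * ln (8 / delta)) in sqE *.
have c1 : 1 <= c by rewrite -[leLHS]sqrtr1 ler_wsqrtr//; lra.
rewrite sqE.
have b_term : 3 * b * sigma * r / Num.sqrt n%:R <= 2 * Num.sqrt 2 * (2 * b * r * sigma / Num.sqrt n%:R).
  rewrite (_ : 3 * b * sigma * r / _ = 3 / 2 * (2 * b * r * sigma / Num.sqrt n%:R)); last by field; rewrite gt_eqF.
  rewrite ler_wpM2r//; first by rewrite divr_ge0 ?(ltW sn0)// !mulr_ge0// ltW.
  have : 1 <= Num.sqrt 2 :> R by rewrite -[leLHS]sqrtr1 ler_wsqrtr//; lra.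
  lra.
(* If Lam = 0 the inverse temperature at level 0 would divide by zero; but then the loss vanishes
   identically and so does the gap. *)
have [Lam00|Lam1] := eqVneq Lam 0.
  exists setT; split; first exact: measurableT.
    by rewrite [X in (_ <= X)%E]probability_setT lee_fin; lra.
  move=> S _ w _.
  have F0 v p : F v p = 0.
    by apply/eqP; rewrite -normr_le0 (le_trans (hLam v p))// Lam00 mul0r.
  rewrite /gap /risk Lam00 !mul0r !addr0.
  rewrite big1 => [|i _]; last exact: F0.
  rewrite (_ : (\int[D]_p F w p)%R = 0); last first.
    rewrite -[RHS](Rintegral_probability_cst D 0).
    by apply: eq_Rintegral => p _; exact: F0.
  rewrite mulr0 subr0 addr_ge0//.
    by rewrite !mulr_ge0 ?invr_ge0 ?sqrtr_ge0 ?(ltW sigma0).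
  apply: mulr_ge0; first by apply: mulr_ge0; [rewrite !mulr_ge0|exact: sqr_ge0].
  by rewrite divr_ge0 ?sqrtr_ge0.
have {}Lam0 : 0 < Lam by rewrite lt_neqAle eq_sym Lam1.
(* If [b = 0] there is no smoothing error, and the inverse temperature at a
   scale [j > 0] would be a division by zero. *)
pose K := if b == 0 then 0%N else n.
have hK : (0 < K)%N -> 0 < b.
  by rewrite /K; case: eqP => // /eqP bn0 _; rewrite lt_neqAle eq_sym bn0.
have [E [mE PE hE]] :=
  multiscale_bound D m0 n0 lF Lam0 hLam b0 hK hb r0 sigma0 delta0 delta1.
exists E; split=> // S ES w wr; apply: le_trans (hE S ES w wr) _.
have remainder : 2 * (b * (sigma / 2 ^+ K) ^+ 2) <= 2 * b * sigma ^+ 2 * (c / Num.sqrt n%:R).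
  rewrite /K; case: eqP => [->|_]; first by rewrite !(mul0r, mulr0).
  rewrite expr_div_n -exprM mulnC exprM (_ : 2 ^+ 2 = 4 :> R); last by ring.
  rewrite !mulrA -[leRHS]mulrA; apply: ler_wpM2l.
    by rewrite !mulr_ge0// ltW.
  apply: (@le_trans _ _ (Num.sqrt n%:R)^-1).
    by rewrite lef_pV2 ?posrE ?exprn_gt0// sqrt_le_4X.
  by rewrite ler_peMl// invr_ge0 ltW.
rewrite (_ : 3 * b * sigma * (r + c * sigma) / Num.sqrt n%:R =
  3 * b * sigma * r / Num.sqrt n%:R + 3 / 2 * (2 * b * sigma ^+ 2 * (c / Num.sqrt n%:R))); last first.
  by field; rewrite gt_eqF.
rewrite (_ : Lam * sigma * Num.sqrt m.+1%:R / Num.sqrt n%:R *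
    (sqn w / (sigma ^+ 2 *+ 2) + 2^-1 + ln (2 / delta)) =
  Lam * Num.sqrt m.+1%:R / (2 * sigma * Num.sqrt n%:R) * sqn w +
  Lam * sigma * Num.sqrt m.+1%:R / Num.sqrt n%:R * (ln (2 / delta) + 2^-1)); last first.
  by field; rewrite !gt_eqF.
rewrite (_ : 4 * (2 * b) * sigma ^+ 2 * (c / Num.sqrt n%:R) =
  4 * (2 * b * sigma ^+ 2 * (c / Num.sqrt n%:R))); last by ring.
have : 0 <= 2 * b * sigma ^+ 2 * (c / Num.sqrt n%:R).
  apply: mulr_ge0; first by apply: mulr_ge0; [rewrite mulr_ge0|exact: sqr_ge0].
  by rewrite divr_ge0 ?sqrtr_ge0.
move: remainder b_term; clear.
move: (2 * b * sigma ^+ 2 * _) (2 * Num.sqrt 2 * _) (2 * (b * _)) (3 * b * sigma * r / _)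
  (_ * sqn w) (_ * (ln _ + _)) => x1 x2 x3 x4 x5 x6.
lra.
Qed.

End gap_bound.

(** * Smooth losses of linear predictors *)

Section euclidean.
Context {R : realType}.

(** By Lagrange's identity: the defect is half the sum of the squares (a_i b_j - a_j b_i)^2. *)
Lemma cauchy_schwarz (I : finType) (a b : I -> R) :
  (\sum_i a i * b i) ^+ 2 <= (\sum_i a i ^+ 2) * (\sum_i b i ^+ 2).
Proof.
have E : \sum_i \sum_j (a i * b j - a j * b i) ^+ 2 =
    2 * ((\sum_i a i ^+ 2) * (\sum_i b i ^+ 2) - (\sum_i a i * b i) ^+ 2).
  transitivity ((\sum_i a i ^+ 2) * (\sum_i b i ^+ 2)
      + (\sum_i b i ^+ 2) * (\sum_i a i ^+ 2)
      - 2 * ((\sum_i a i * b i) * (\sum_i a i * b i))); last by ring.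
  rewrite !big_distrlr/= mulr_sumr -big_split -sumrB/=; apply: eq_bigr => i _.
  rewrite mulr_sumr -big_split -sumrB/=; apply: eq_bigr => j _; ring.
have : 0 <= \sum_i \sum_j (a i * b j - a j * b i) ^+ 2.
  by apply: sumr_ge0 => i _; apply: sumr_ge0 => j _; exact: sqr_ge0.
by rewrite E; lra.
Qed.

Lemma euclidean_norm_ge0 n (v : 'cV[R]_n) : 0 <= euclidean_norm v.
Proof. exact: sqrtr_ge0. Qed.

Lemma euclidean_norm_sqr n (v : 'cV[R]_n) : euclidean_norm v ^+ 2 = \sum_i v i 0 ^+ 2.
Proof. by rewrite sqr_sqrtr// sumr_ge0// => i _; exact: sqr_ge0. Qed.

Lemma euclidean_normZ n k (v : 'cV[R]_n) :
  euclidean_norm (k *: v) = `|k| * euclidean_norm v.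
Proof.
rewrite /euclidean_norm; under eq_bigr do rewrite mxE exprMn.
by rewrite -mulr_sumr sqrtrM ?sqr_ge0// sqrtr_sqr.
Qed.

Lemma dot_le_euclidean n (u v : 'cV[R]_n) :
  `|\sum_i u i 0 * v i 0| <= euclidean_norm u * euclidean_norm v.
Proof.
rewrite -[leLHS]sqrtr_sqr -sqrtrM ?sumr_ge0// => [|i _]; last exact: sqr_ge0.
by rewrite ler_wsqrtr// cauchy_schwarz.
Qed.

Lemma euclidean_norm_mulmx p q (W : 'M[R]_(p, q)) (x : 'cV[R]_q) :
  euclidean_norm (W *m x) <= frobenius_norm W * euclidean_norm x.
Proof.
rewrite -sqrtrM; last first.
  by rewrite sumr_ge0// => i _; rewrite sumr_ge0// => j _; exact: sqr_ge0.
rewrite ler_wsqrtr// mulr_suml ler_sum// => i _.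
by rewrite mxE cauchy_schwarz.
Qed.

Lemma is_derive_line n (f : 'cV[R]_n -> R) (z v : 'cV[R]_n) (t : R) :
  (forall x, differentiable f x) ->
  is_derive t (1 : R) (fun s : R => f (z + s *: v))
    (\sum_i gradient f (z + t *: v) i 0 * v i 0).
Proof.
move=> df.
(* The difference quotient of the restriction to the line coincides with that of f in direction
   v. *)
have E : (fun h : R => h^-1 *: (f (z + (h *: (1 : R) + t) *: v) - f (z + t *: v))) =
  (fun h : R => h^-1 *: (f (h *: v + (z + t *: v)) - f (z + t *: v))).
  apply/funext => h; congr (_ *: (f _ - _)).
  have -> : h *: (1 : R) = h by rewrite /GRing.scale/= mulr1.
  by rewrite scalerDl addrCA.
have dv : derivable f (z + t *: v) v by exact: diff_derivable.
have d1 : derivable (fun s : R => f (z + s *: v)) t (1 : R).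
  by rewrite /derivable /= E; exact: dv.
apply: DeriveDef => //.
rewrite /derive /= E -/(derive f (z + t *: v) v) deriveE//.
have vE : v = \sum_i v i 0 *: delta_mx i 0.
  rewrite [LHS]matrix_sum_delta; apply: eq_bigr => i _.
  by rewrite big_ord1.
rewrite [X in 'd _ _ X]vE linear_sum; apply: eq_bigr => i _.
by rewrite linearZ mxE mulrC.
Qed.

(** For g(t) = f(z + t v) + f(z - t v), the derivative pairs v with a difference of gradients at
    points 2 t v apart. Hence |g'(t)| <= 2 t beta |v|^2, and integrating over [0, 1] gives the
    constant beta. *)
Lemma smooth_second_difference n (beta : R) (f : 'cV[R]_n -> R) (z v : 'cV[R]_n) :
  smooth beta f ->
  `|f (z + v) + f (z - v) - 2 * f z| <= beta * euclidean_norm v ^+ 2.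
Proof.
move=> [df lipg].
pose g (t : R) := f (z + t *: v) + f (z + t *: - v).
pose q (t : R) := (\sum_i gradient f (z + t *: v) i 0 * v i 0)
  + \sum_i gradient f (z + t *: - v) i 0 * (- v) i 0.
have dg t : is_derive t (1 : R) g (q t).
  by apply: is_deriveD; exact: is_derive_line.
have qle t : 0 <= t -> `|q t| <= beta * euclidean_norm v ^+ 2 * (2 * t).
  move=> t0.
  have -> : q t = \sum_i (gradient f (z + t *: v) - gradient f (z + t *: - v)) i 0 * v i 0.
    rewrite /q; move: (gradient f (z + t *: v)) (gradient f (z + t *: - v)) => x y.
    by rewrite -big_split/=; apply: eq_bigr => i _; rewrite !mxE; ring.
  rewrite (le_trans (dot_le_euclidean _ _))//.
  rewrite (_ : _ * (2 * t) = beta * ((2 * t) * euclidean_norm v) * euclidean_norm v); last by ring.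
  rewrite ler_wpM2r ?euclidean_norm_ge0// (le_trans (lipg _ _))//.
  rewrite (_ : _ - _ = (2 * t) *: v); last first.
    by apply/colP => i; rewrite !mxE; ring.
  by rewrite euclidean_normZ ger0_norm ?mulr_ge0.
have dc t : is_derive t (1 : R) (fun s => beta * euclidean_norm v ^+ 2 * s ^+ 2)
    (beta * euclidean_norm v ^+ 2 * (2 * t)).
  apply: is_derive_eq; rewrite /GRing.scale/=; ring.
have g0 : g 0 = 2 * f z by rewrite /g !scale0r !addr0; ring.
have g1 : g 1 = f (z + v) + f (z - v) by rewrite /g !scale1r.
have up0 t : 0 <= t -> 0 <= beta * euclidean_norm v ^+ 2 * (2 * t) - q t.
  by move=> /qle; rewrite ler_norml => /andP[_]; rewrite subr_ge0.
have lo0 t : 0 <= t -> 0 <= beta * euclidean_norm v ^+ 2 * (2 * t) + q t.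
  by move=> /qle; rewrite ler_norml => /andP[]; rewrite -subr_ge0 opprK addrC.
(* Integration is replaced by monotonicity of beta |v|^2 t^2 - g(t) and beta |v|^2 t^2 + g(t) on
   [0, 1]. *)
have up := is_derive_ge0_le ler01 (fun t => is_deriveB (dc t) (dg t)) up0.
have lo := is_derive_ge0_le ler01 (fun t => is_deriveD (dc t) (dg t)) lo0.
move: up lo; rewrite /= !fctE /= g0 g1 expr0n expr1n /= mulr0 mulr1.
by move=> up lo; rewrite ler_norml; apply/andP; split; lra.
Qed.

End euclidean.

Section linear_predictors.
Context {R : realType} {C d : nat} {dY : measure_display} {Y : measurableType dY}.
Variables (L : 'cV[R]_C -> Y -> R) (M l beta : R).
Variable G : set (borel_cV R d * Y).
Local Notation T := (borel_cV R d * Y)%type.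
Local Notation RR := (measurableTypeR R).
Implicit Types (v w : 'rV[R]_(C * d)) (p : T).
Hypotheses (M0 : 0 <= M) (l0 : 0 <= l) (beta0 : 0 <= beta).
Hypothesis mG : measurable G.
Hypothesis GM : forall p, G p -> euclidean_norm (p.1 : 'cV[R]_d) <= M.
Hypothesis hLip : forall y, euclidean_lipschitz_real l (fun z => L z y).
Hypothesis hSmooth : forall y, smooth beta (fun z => L z y).
Hypothesis hLmeas : forall W : 'M[R]_(C, d),
  measurable_fun [set: T] (loss_at L (linear_hypothesis W)).

(* The indicator of the full-measure set [G] makes the bounds below hold
   everywhere instead of almost everywhere. *)
Definition centered_loss v p : R :=
  \1_G p * (loss_at L (linear_hypothesis (vec_mx v)) p - L 0 p.2).

Lemma sum_mxvec_index (g : 'I_(C * d) -> R) :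
  \sum_k g k = \sum_i \sum_j g (mxvec_index i j).
Proof.
rewrite pair_bigA /= (reindex (uncurry (@mxvec_index C d))) /=.
  by apply: eq_bigr => -[i j].
exact: curry_mxvec_bij.
Qed.

Lemma frobenius_norm_vec_mx v : frobenius_norm (vec_mx v) = Num.sqrt (sqn v).
Proof.
rewrite /frobenius_norm /sqn sum_mxvec_index; congr Num.sqrt.
by apply: eq_bigr => i _; apply: eq_bigr => j _; rewrite mxE.
Qed.

Lemma sqrt_sqn_le_l1 v : Num.sqrt (sqn v) <= l1 v.
Proof.
rewrite -[leRHS](ger0_norm (l1_ge0 v)) -sqrtr_sqr ler_wsqrtr//.
rewrite expr2 {1}/l1 mulr_suml ler_sum// => i _.
rewrite -real_normK ?num_real// expr2 ler_wpM2l//.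
by rewrite /l1 (bigD1 i)//= lerDl sumr_ge0.
Qed.

Lemma loss_at_lipschitz v w p : G p ->
  `|loss_at L (linear_hypothesis (vec_mx v)) p -
    loss_at L (linear_hypothesis (vec_mx w)) p| <=
  M * l * Num.sqrt (sqn (v - w)).
Proof.
move=> Gp; rewrite /loss_at /linear_hypothesis (le_trans (hLip p.2 _ _))//.
rewrite -mulmxBl -raddfB (mulrC M) -mulrA ler_wpM2l//.
rewrite (le_trans (euclidean_norm_mulmx _ _))// frobenius_norm_vec_mx mulrC.
by rewrite ler_wpM2r ?sqrtr_ge0// GM.
Qed.

Lemma loss_at0 p : loss_at L (linear_hypothesis (vec_mx 0)) p = L 0 p.2.
Proof. by rewrite /loss_at /linear_hypothesis raddf0 mul0mx. Qed.

Lemma centered_lossE v p : G p ->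
  centered_loss v p = loss_at L (linear_hypothesis (vec_mx v)) p - L 0 p.2.
Proof. by move=> Gp; rewrite /centered_loss indicE mem_set// mul1r. Qed.

Lemma centered_loss_out v p : ~ G p -> centered_loss v p = 0.
Proof. by move=> Gp; rewrite /centered_loss indicE memNset// mul0r. Qed.

Lemma centered_loss_bound v p : `|centered_loss v p| <= M * l * Num.sqrt (sqn v).
Proof.
have [Gp|Gp] := pselect (G p).
  rewrite centered_lossE// -(loss_at0 p) (le_trans (loss_at_lipschitz _ _ Gp))//.
  by rewrite subr0.
by rewrite centered_loss_out// normr0 !mulr_ge0 ?sqrtr_ge0.
Qed.

Lemma centered_loss_lipschitz p : l1_lipschitz (M * l) (centered_loss ^~ p).
Proof.
move=> v w; have [Gp|Gp] := pselect (G p).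
  rewrite !centered_lossE// opprB addrA subrK (le_trans (loss_at_lipschitz _ _ Gp))//.
  by rewrite ler_wpM2l ?mulr_ge0// sqrt_sqn_le_l1.
by rewrite !centered_loss_out// subrr normr0 !mulr_ge0 ?l1_ge0.
Qed.

Lemma centered_loss_family : loss_family (M * l) centered_loss.
Proof.
split=> [v|p|v].
- apply: measurable_funM; first exact: measurable_indic.
  apply: measurable_funB; first exact: hLmeas.
  rewrite (_ : (fun p : T => L 0 p.2) = loss_at L (linear_hypothesis (vec_mx 0))).
    exact: hLmeas.
  by apply/funext => p; rewrite loss_at0.
- exact: centered_loss_lipschitz.
- by eexists => p; exact: centered_loss_bound.
Qed.

(** Each of the C entries of U x is a linear form in U whose coefficient vector has norm |x|; this
    is the source of the factor C. *)
Lemma integral_gauss_euclidean_le (s : R) (x : 'cV[R]_d) : 0 < s ->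
  (\int[iid_probability (normal_prob (0 : R) s) (C * d)]_u
    (euclidean_norm (vec_mx (row_of u) *m x) ^+ 2)%:E <=
   (C%:R * euclidean_norm x ^+ 2 * s ^+ 2)%:E)%E.
Proof.
move=> s0.
(* The flattening of the matrix whose row c is x and whose other rows vanish. *)
pose a (c : 'I_C) (k : 'I_(C * d)) : R :=
  mxvec (\matrix_(i, j) ((i == c)%:R * x j 0)) 0 k.
have aE c (u : (C * d).-tuple R) :
    (vec_mx (row_of u) *m x) c 0 = \sum_k a c k * tnth u k.
  rewrite mxE sum_mxvec_index (bigD1 c)//= [X in _ + X]big1 ?addr0.
    by apply: eq_bigr => j _; rewrite /a mxvecE !mxE eqxx mul1r mulrC.
  move=> i /negbTE ic; apply: big1 => j _.
  by rewrite /a mxvecE mxE ic !mul0r.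
have a2 c : \sum_k a c k ^+ 2 = euclidean_norm x ^+ 2.
  rewrite sum_mxvec_index (bigD1 c)//= [X in _ + X]big1 ?addr0.
    rewrite euclidean_norm_sqr; apply: eq_bigr => j _.
    by rewrite /a mxvecE mxE eqxx mul1r.
  move=> i /negbTE ic; apply: big1 => j _.
  by rewrite /a mxvecE mxE ic mul0r expr0n.
have ma c : measurable_fun [set: (C * d).-tuple RR]
    (fun u : (C * d).-tuple RR => ((\sum_k a c k * tnth u k) ^+ 2)%:E).
  apply/measurable_EFinP; apply: measurable_funX; apply: measurable_sum => k.
  by apply: measurable_funM => //; exact: measurable_tnthR.
rewrite [X in (X <= _)%E](_ : _ = \int[iid_probability (normal_prob (0 : R) s) (C * d)]_u
    \sum_(c < C) ((\sum_k a c k * tnth u k) ^+ 2)%:E)%E; last first.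
  apply: eq_integral => u _; rewrite euclidean_norm_sqr sumEFin; congr EFin.
  by apply: eq_bigr => c _; rewrite aE.
rewrite ge0_integral_sum; [|exact: measurableT|exact: ma|]; last first.
  by move=> c u _; rewrite lee_fin sqr_ge0.
have h c := integral_gauss_linear_sqr_le (a c) s0.
apply: (le_trans (lee_sum _ (fun c _ => h c))).
rewrite sumEFin lee_fin; under eq_bigr do rewrite a2.
rewrite sumr_const card_ord -mulr_natl le_eqVlt; apply/orP; left; apply/eqP; ring.
Qed.

(** Replacing u by -u and averaging, twice the smoothing gap is minus the Gaussian mean of the
    second difference of the loss. This explains both the quadratic dependence on s and the factor
    1/2. *)
Lemma centered_loss_smoothing (s : R) v p : 0 < s ->
  `|smoothing_gap s centered_loss v p| <= beta * C%:R * M ^+ 2 / 2 * s ^+ 2.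
Proof.
move=> s0; have lF := centered_loss_lipschitz p.
have [Gp|Gp] := pselect (G p); last first.
  rewrite /smoothing_gap centered_loss_out//.
  rewrite (_ : (fun u => _) = (fun=> 0)); last first.
    by apply/funext => u; rewrite centered_loss_out.
  rewrite gauss_mean_cst subrr normr0; apply: mulr_ge0; last exact: sqr_ge0.
  by rewrite divr_ge0 ?mulr_ge0.
have lv := l1_lipschitz_shift v lF.
have lN := l1_lipschitz_opp lv.
have lD := l1_lipschitzD lv lN.
have lc := l1_lipschitz_cst (2 * centered_loss v p) :
  l1_lipschitz 0 (fun _ : 'rV[R]_(C * d) => _).
have lB := l1_lipschitzB lD lc.
set psi := (fun u => _) in lB.
have E : gauss_mean s psi = - (2 * smoothing_gap s centered_loss v p).
  rewrite (gauss_meanB s0 lD lc) (gauss_meanD s0 lv lN) (gauss_mean_opp s0 lv).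
  by rewrite gauss_mean_cst /smoothing_gap; ring.
have psi_le u : `|psi u| <= beta * euclidean_norm (vec_mx u *m (p.1 : 'cV[R]_d)) ^+ 2.
  have := smooth_second_difference (vec_mx v *m (p.1 : 'cV[R]_d))
    (vec_mx u *m (p.1 : 'cV[R]_d)) (hSmooth p.2).
  apply: le_trans; rewrite le_eqVlt; apply/orP; left; apply/eqP; congr `|_|.
  rewrite /psi !centered_lossE// /loss_at /linear_hypothesis.
  rewrite raddfD raddfB /= mulmxDl mulmxBl; ring.
have : `|gauss_mean s psi| <= beta * (C%:R * M ^+ 2 * s ^+ 2).
  have mpsi := measurable_l1_lipschitz lB.
  have mnorm : measurable_fun [set: (C * d).-tuple RR] (fun u : (C * d).-tuple RR =>
      (euclidean_norm (vec_mx (row_of u) *m (p.1 : 'cV[R]_d)) ^+ 2)%:E).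
    apply/measurable_EFinP; under eq_fun do rewrite euclidean_norm_sqr.
    apply: measurable_sum => c; apply: measurable_funX; under eq_fun do rewrite mxE.
    apply: measurable_sum => j; apply: measurable_funM => //.
    by under eq_fun do rewrite !mxE; exact: measurable_tnthR.
  have norm0 (u : (C * d).-tuple RR) :
      (0 <= (euclidean_norm (vec_mx (row_of u) *m (p.1 : 'cV[R]_d)) ^+ 2)%:E)%E.
    by rewrite lee_fin sqr_ge0.
  rewrite -lee_fin -abse_EFin (gauss_meanE s0 lB).
  apply: (le_trans (le_abse_integral _ measurableT _)).
    exact/measurable_EFinP.
  apply: (@le_trans _ _ (beta%:E * \int[iid_probability (normal_prob (0 : R) s) (C * d)]_u
      (euclidean_norm (vec_mx (row_of u) *m (p.1 : 'cV[R]_d)) ^+ 2)%:E)%E).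
    rewrite -ge0_integralZl; [|exact: measurableT|exact: mnorm|by move=> u _; exact: norm0|by rewrite lee_fin].
    apply: ge0_le_integral.
    - exact: measurableT.
    - by move=> u _; exact: abse_ge0.
    - by apply: measurableT_comp => //; exact/measurable_EFinP.
    - exact: measurable_funeM.
    - by move=> u _ /=; rewrite -EFinM lee_fin psi_le.
  rewrite EFinM; apply: lee_wpmul2l; first by rewrite lee_fin.
  apply: (le_trans (integral_gauss_euclidean_le _ s0)).
  rewrite lee_fin ler_wpM2r ?sqr_ge0// ler_wpM2l//.
  by apply: lerXn2r; rewrite ?nnegrE ?euclidean_norm_ge0// GM.
rewrite E normrN normrM ger0_norm// => h.
rewrite -(ler_pM2l (ltr0n R 2)) (le_trans h)//.
rewrite le_eqVlt; apply/orP; left; apply/eqP; by field.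
Qed.

End linear_predictors.

(** * Null sets and the generalization bound *)

Section iid_almost_sure.
Context {d : measure_display} {T : measurableType d} {R : realType}.
Variables (P : probability T R) (n : nat) (G : set T).
Hypotheses (mG : measurable G) (PG : P G = 1%E).

Let all_in := [set s : n.-tuple T | forall i, G (tnth s i)].

Lemma measurable_iid_all_in : measurable all_in.
Proof.
rewrite (_ : all_in = \bigcap_(i in [set: 'I_n])
    ((@tnth _ T)^~ i @^-1` G)); last first.
  by apply/seteqP; split=> s /= H i; [move=> _; exact: H | exact: (H i I)].
apply: fin_bigcap_measurable => // i _.
by rewrite -[X in measurable X]setTI; exact: measurable_tnth.
Qed.

(** All n sample points lie in [G] with probability 1 by the box formula, so the good event can be
    restricted to such samples at no cost. *)
Lemma iid_probability_setI_all_in (E : set (n.-tuple T)) : measurable E ->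
  iid_probability P n (E `&` all_in) = iid_probability P n E.
Proof.
move=> mE; have mA := measurable_iid_all_in.
have PA : iid_probability P n all_in = 1%E.
  by rewrite (iid_probability_box P (fun=> mG)) big1.
rewrite [RHS](measureDI _ mE mA) [X in (X + _)%E](_ : _ = 0%E) ?add0e//.
apply/eqP; rewrite eq_le measure_ge0 andbT.
have <- : iid_probability P n (~` all_in) = 0%E.
  by rewrite probability_setC// PA subee.
apply: le_measure => [||s []//]; rewrite inE.
  exact: measurableD.
exact: measurableC.
Qed.

End iid_almost_sure.

(** It recovers the signs of [l] and [beta] from one pair of distinct points, available because n >
    0. *)
Lemma euclidean_lipschitz_ge0 (R : realType) (n : nat) (k : R) :
  (0 < n)%N -> (forall u v : 'cV[R]_n, 0 <= k * euclidean_norm (u - v)) -> 0 <= k.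
Proof.
move=> n0 /(_ (const_mx 1) 0); rewrite pmulr_lge0//.
rewrite subr0 sqrtr_gt0; under eq_bigr do rewrite mxE expr1n.
by rewrite sumr_const card_ord ltr0n.
Qed.

Theorem theorem4p1 (R : realType) (C d n : nat)
    (hC : (0 < C)%N) (hd : (0 < d)%N) (hn : (0 < n)%N)
    (X : set 'cV[R]_d) (M : R) (hX : forall x, X x -> euclidean_norm x <= M)
    (dY : measure_display) (Y : measurableType dY)
    (L : 'cV[R]_C -> Y -> R) (l beta : R)
    (hLip : forall y, euclidean_lipschitz_real l (fun z => L z y))
    (hSmooth : forall y, smooth beta (fun z => L z y))
    (hL0 : forall y y', L 0 y = L 0 y')
    (hLmeas : forall W : 'M[R]_(C, d),
       measurable_fun [set: borel_cV R d * Y] (loss_at L (linear_hypothesis W)))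
    (D : probability (borel_cV R d * Y)%type R)
    (hD : {ae D, forall p, X p.1})
    (radius sigma delta : R) (hsigma : 0 < sigma)
    (hdelta0 : 0 < delta) (hdelta1 : delta <= 1) :
  with_probability_at_least (iid_probability D n) (1 - delta)
    [set S : n.-tuple (borel_cV R d * Y) |
      forall W : 'M[R]_(C, d), frobenius_norm W <= radius ->
      (population_risk L D (linear_hypothesis W) <=
       (empirical_risk L S (linear_hypothesis W)
        + 2 * Num.sqrt 2 *
            ((beta * radius * sigma * C%:R * M ^+ 2) / Num.sqrt n%:R)
        + 4 * beta * C%:R * M ^+ 2 * sigma ^+ 2 *
            Num.sqrt (2 * ln (8 / delta) / n%:R)
        + (M * l * Num.sqrt (C * d + 1)%:R) / (2 * sigma * Num.sqrt n%:R) *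
            frobenius_norm W ^+ 2
        + (M * l * sigma * Num.sqrt (C * d + 1)%:R) / Num.sqrt n%:R *
            (ln (2 / delta) + 2^-1))%:E)%E].
Proof.
(* [X] itself may fail to be measurable; the complement [G] of a measurable null set replaces it. *)
case: hD => N [mN N0 XN].
pose G := ~` N.
have mG : measurable G by exact: measurableC.
have GX p : G p -> X p.1 by move=> Np; apply: contrapT => Xp; apply: Np; exact: XN.
have DG : D G = 1%E by rewrite probability_setC// N0 sube0.
(* A point of [G] witnesses 0 <= M and supplies a label at which the Lipschitz conditions can be
   tested. *)
have [p0 Gp0] : G !=set0.
  apply/set0P/eqP => G0; move: DG; rewrite G0 measure0 => /eqP.
  by rewrite eq_sym onee_eq0.
have GM p : G p -> euclidean_norm (p.1 : 'cV[R]_d) <= M by move=> /GX /hX.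
have M0 : 0 <= M by rewrite (le_trans _ (GM _ Gp0))// sqrtr_ge0.
have l0 : 0 <= l.
  by apply: (euclidean_lipschitz_ge0 hC) => u v; rewrite (le_trans _ (hLip p0.2 u v)).
have beta0 : 0 <= beta.
  apply: (euclidean_lipschitz_ge0 hC) => u v.
  by rewrite (le_trans _ ((hSmooth p0.2).2 u v))// sqrtr_ge0.
(* For a negative radius no weight matrix qualifies, and the whole space serves as the event. *)
have [radius0|radius0] := leP 0 radius; last first.
  exists setT; split=> //; last first.
    by rewrite [X in (_ <= X)%E]probability_setT lee_fin gerBl ltW.
  move=> S _ W Wr; have := sqrtr_ge0 (\sum_i \sum_j W i j ^+ 2).
  by rewrite -/(frobenius_norm W) => /le_trans/(_ Wr); rewrite leNgt radius0.
have m0 : (0 < C * d)%N by rewrite muln_gt0 hC.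
have lF := centered_loss_family M0 l0 mG GM hLip hLmeas.
have b0 : 0 <= beta * C%:R * M ^+ 2 / 2 by rewrite divr_ge0// !mulr_ge0.
have [E [mE PE hE]] := gap_bound D m0 hn lF (mulr_ge0 M0 l0)
  (centered_loss_bound M0 l0 GM hLip) b0
  (fun s v p => centered_loss_smoothing M0 l0 beta0 GM hLip hSmooth v p)
  radius0 hsigma hdelta0 hdelta1.
exists (E `&` [set s | forall i, G (tnth s i)]); split.
- by apply: measurableI => //; exact: measurable_iid_all_in.
- move=> S [/hE{}hE SG] W Wr.
  (* By [hL0] centering subtracts this one constant on [G], so it shifts the risk and the empirical
     risk alike and drops out of the gap. *)
  pose k := L 0 p0.2.
  have kE y : L 0 y = k by exact: hL0.
  have cE p : G p ->
      loss_at L (linear_hypothesis W) p = centered_loss L G (mxvec W) p + k.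
    by move=> Gp; rewrite centered_lossE// mxvecK kE subrK.
  have -> : population_risk L D (linear_hypothesis W) =
      (risk D (centered_loss L G) (mxvec W) + k)%:E.
    have iF := loss_integrable D (mxvec W) lF.
    rewrite /population_risk unlock.
    transitivity (\int[D]_p ((centered_loss L G (mxvec W) p)%:E + k%:E))%E.
      apply: ae_eq_integral => //.
      - exact/measurable_EFinP.
      - apply: emeasurable_funD => //; apply/measurable_EFinP.
        exact: loss_measurable lF _.
      - exists N; split=> // p /= h; apply: contrapT => Np; apply: h => _.
        by rewrite cE// EFinD.
    rewrite integralD//; last exact: finite_measure_integrable_cst.
    rewrite integral_cst// [X in (_ + _ * X)%E]probability_setT mule1.
    rewrite EFinD /risk /Rintegral fineK//.
    exact: integrable_fin_num.
  have -> : empirical_risk L S (linear_hypothesis W) =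
      n%:R^-1 * (\sum_(i < n) centered_loss L G (mxvec W) (tnth S i)) + k.
    rewrite /empirical_risk (eq_bigr _ (fun i _ => cE _ (SG i))) big_split/=.
    rewrite sumr_const card_ord mulrDr -[k *+ n]mulr_natl mulKf//.
    by rewrite pnatr_eq0 -lt0n.
  have sW : sqn (mxvec W) = frobenius_norm W ^+ 2.
    rewrite -[in RHS](mxvecK W) frobenius_norm_vec_mx sqr_sqrtr//.
    exact: sqn_ge0.
  have := hE (mxvec W); rewrite sW => /(_ _)/wrap[].
    by apply: lerXn2r; rewrite ?nnegrE ?sqrtr_ge0.
  rewrite /gap lee_fin addn1 => h.
  rewrite (_ : 2 * (beta * C%:R * M ^+ 2 / 2) = beta * C%:R * M ^+ 2) in h; last by field.
  rewrite -subr_ge0; move: h; rewrite -subr_ge0 => h; apply: (le_trans h).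
  by rewrite le_eqVlt; apply/orP; left; apply/eqP; ring.
- by rewrite iid_probability_setI_all_in.
Qed.
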